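(* Let $m\ge 1$ and let $\psi$ be a wavelet on $\mathbb{R}^n$ for which there are constants $A,\varepsilon,\varepsilon'>0$ such that $|\psi(x)|\le A(1+|x|)^{-n-\varepsilon}$ for all $x\in\mathbb{R}^n$ and $\int_{\mathbb{R}^n}|\psi(x-y)-\psi(x)|\,dx\le A|y|^{\varepsilon'}$ for all $y\neq 0$. (1) If $\psi$ is a Littlewood–Paley wavelet for the continuous wavelet transform with constant $C_\psi$, then $S^m_{\mathrm{cont},2}$ maps $L^2(\mathbb{R}^n)$ into $L^2(\mathbb{R}_+^m)$ and $\|S^m_{\mathrm{cont},2}f\|_{L^2(\mathbb{R}_+^m)}^2=C_\psi^m\|f\|_2^2$ for all $f\in L^2(\mathbb{R}^n)$. (2) If $\psi$ is a Littlewood–Paley wavelet for the dyadic wavelet transform with constant $\hat C_\psi$, then $S^m_{\mathrm{dyad},2}$ maps $L^2(\mathbb{R}^n)$ into $\ell^2(\mathbb{Z}^m)$ and $\|S^m_{\mathrm{dyad},2}f\|_{\ell^2(\mathbb{Z}^m)}^2=\hat C_\psi^m\|f\|_2^2$ for all $f\in L^2(\mathbb{R}^n)$.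
   Context: $\mathbb{R}_+=(0,\infty)$; $\hat f(\omega)=\int f(x)e^{-ix\cdot\omega}dx$. A wavelet is a function $\psi:\mathbb{R}^n\to\mathbb{C}$ in $L^1(\mathbb{R}^n)\cap L^2(\mathbb{R}^n)$ with $\int\psi=0$. It is Littlewood–Paley for the continuous wavelet transform with constant $C_\psi>0$ if $\int_0^\infty|\hat\psi(\lambda\omega)|^2\frac{d\lambda}{\lambda}=C_\psi$ for all $\omega\in\mathbb{R}^n\setminus\{0\}$, and Littlewood–Paley for the dyadic wavelet transform with constant $\hat C_\psi>0$ if $\sum_{j\in\mathbb{Z}}|\hat\psi(2^j\omega)|^2=\hat C_\psi$ for all $\omega\in\mathbb{R}^n\setminus\{0\}$. For $\lambda\in\mathbb{R}_+$, $\psi_\lambda(x)=\lambda^{-n/2}\psi(\lambda^{-1}x)$; for $j\in\mathbb{Z}$, $\psi_j(x)=2^{-nj}\psi(2^{-j}x)$. The $m$-layer scattering transforms are $$S^m_{\mathrm{cont},2}f(\lambda_1,\dots,\lambda_m)=\big\|\,|\cdots||f*\psi_{\lambda_1}|*\psi_{\lambda_2}|*\cdots|*\psi_{\lambda_m}\big\|_{L^2(\mathbb{R}^n)},\qquad S^m_{\mathrm{dyad},2}f(j_1,\dots,j_m)=\big\|\,|\cdots||f*\psi_{j_1}|*\psi_{j_2}|*\cdots|*\psi_{j_m}\big\|_{L^2(\mathbb{R}^n)}$$ (a modulus is taken after each of the first $m-1$ convolutions). The norms are $$\|F\|_{L^2(\mathbb{R}_+^m)}^2=\int_0^\infty\cdots\int_0^\infty|F(\lambda_1,\dots,\lambda_m)|^2\frac{d\lambda_1}{\lambda_1^{n+1}}\cdots\frac{d\lambda_m}{\lambda_m^{n+1}}$$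 and $\|F\|_{\ell^2(\mathbb{Z}^m)}^2=\sum_{j_1,\dots,j_m\in\mathbb{Z}}|F(j_1,\dots,j_m)|^2$. *)

(* Defs.v *)
From HB Require Import structures.
From mathcomp Require Import all_boot all_order all_algebra.
From mathcomp Require Import all_classical all_reals all_analysis.
From mathcomp Require Import measurable_realfun complex.

Set Implicit Arguments.
Unset Strict Implicit.
Unset Printing Implicit Defensive.

Import Order.TTheory GRing.Theory Num.Theory.
Import numFieldNormedType.Exports.

Local Open Scope classical_set_scope.
Local Open Scope ring_scope.
Local Open Scope complex_scope.

(* Vectors of R^n are row vectors 'rV[R]_n, measurable for the product
   sigma-algebra, i.e., the Borel sigma-algebra generated by the coordinates. *)
Section measurable_rV.
Context {d} {T : sigmaRingType d} (n : nat).

Let coord : 'I_n -> 'rV[T]_n -> T := fun i x => x ord0 i.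

Let rV_set0 : g_sigma_preimage coord set0.
Proof. exact: sigma_algebra0. Qed.

Let rV_setC A : g_sigma_preimage coord A -> g_sigma_preimage coord (~` A).
Proof. exact: sigma_algebraC. Qed.

Let rV_bigcup (F : (set 'rV[T]_n)^nat) :
  (forall i, g_sigma_preimage coord (F i)) ->
  g_sigma_preimage coord (\bigcup_i (F i)).
Proof. exact: sigma_algebra_bigcup. Qed.

HB.instance Definition _ := @isMeasurable.Build (measure_tuple_display d)
  'rV[T]_n (g_sigma_preimage coord) rV_set0 rV_setC rV_bigcup.

End measurable_rV.

Lemma measurable_coord d (T : sigmaRingType d) n (i : 'I_n) :
  measurable_fun [set: 'rV[T]_n] (fun x => x ord0 i).
Proof.
move=> _ Y mY; rewrite setTI; apply: sub_sigma_algebra => /=.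
rewrite -bigcup_seq/=; exists i => /=; first by rewrite mem_index_enum.
by exists Y => //; rewrite setTI.
Qed.

Lemma measurable_fun_coordP d1 d2 (T1 : measurableType d1)
    (T2 : measurableType d2) n (f : T1 -> 'rV[T2]_n) :
  measurable_fun [set: T1] f <->
  forall i, measurable_fun [set: T1] (fun x => f x ord0 i).
Proof.
split=> [mf i|mf].
  exact: (measurableT_comp (measurable_coord i) mf).
have : @g_sigma_preimage _ T2 _ _ (fun i x => f x ord0 i) `<=` measurable.
  apply: smallest_sub; first exact: sigma_algebra_measurable.
  case: n => [|n] in f mf *; first by rewrite big_ord0.
  rewrite -bigcup_mkord_ord; apply: bigcup_sub => i Ii.
  by move=> A [B mB <-]; exact: mf.
rewrite (_ : g_sigma_preimage _ =
  g_sigma_preimage (fun i => (fun x : 'rV[T2]_n => x ord0 i) \o f))//.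
rewrite g_sigma_preimage_comp => sub _ A mA.
by apply: sub; exists A.
Qed.

Section lebesgue_measure_rV.
Context {R : realType}.

Definition consrV n (p : measurableTypeR R * 'rV[R]_n) : 'rV[R]_n.+1 :=
  row_mx p.1%:M p.2.

Lemma consrV0 n (p : measurableTypeR R * 'rV[R]_n) : consrV p ord0 ord0 = p.1.
Proof.
rewrite /consrV (_ : ord0 = lshift n (ord0 : 'I_1)); last exact/val_inj.
by rewrite (@row_mxEl _ 1 1 n) mxE.
Qed.

Lemma consrVS n (p : measurableTypeR R * 'rV[R]_n) i :
  consrV p ord0 (lift ord0 i) = p.2 ord0 i.
Proof.
rewrite /consrV (_ : lift ord0 i = rshift 1 i); last exact/val_inj.
by rewrite (@row_mxEr _ 1 1 n).
Qed.

Lemma measurable_consrV n : measurable_fun setT (@consrV n).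
Proof.
apply/measurable_fun_coordP => i; case: (unliftP ord0 i) => [j ->|->].
- rewrite (_ : (fun _ => _) = (fun x : 'rV[R]_n => x ord0 j) \o snd).
    by apply: measurableT_comp => //; exact: measurable_coord.
  by apply/funext => p /=; rewrite consrVS.
- rewrite (_ : (fun _ => _) = fst); first exact: measurable_fst.
  by apply/funext => p; rewrite consrV0.
Qed.

(* The product of the Lebesgue measure on R and of mu, transported to R^(n+1)
   along the identification R x R^n = R^(n+1). *)
Definition cons_measure n (mu : {measure set 'rV[R]_n -> \bar R}) :
    set 'rV[R]_n.+1 -> \bar R :=
  pushforward (lebesgue_measure \x^ mu)%E (@consrV n).

HB.instance Definition _ n (mu : {measure set 'rV[R]_n -> \bar R}) :=
  Measure.copy (cons_measure mu)
    (measure_function_pushforward__canonical__measure_function_Measure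
       (lebesgue_measure \x^ mu)%E (@measurable_consrV n)).

Fixpoint lebesgue_rV n : {measure set 'rV[R]_n -> \bar R} :=
  match n with
  | 0 => \d_ (0 : 'rV[R]_0)
  | n'.+1 => cons_measure (lebesgue_rV n')
  end.

Lemma lebesgue_rV_box n (A : 'I_n -> set (measurableTypeR R)) :
  (forall i, measurable (A i)) ->
  lebesgue_rV n [set x | forall i, A i (x ord0 i)] =
  (\prod_(i < n) lebesgue_measure (A i))%E.
Proof.
elim: n A => [|n IH] A mA.
  by rewrite big_ord0 /= diracE mem_set// => -[].
rewrite big_ord_recl -IH; last by move=> i; exact: mA.
have mB : measurable [set x : 'rV[R]_n | forall i, A (lift ord0 i) (x ord0 i)].
  rewrite (_ : [set x | _] =
      \bigcap_(i in [set: 'I_n])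
        ((fun x : 'rV[R]_n => x ord0 i) @^-1` A (lift ord0 i))); last first.
    by apply/seteqP; split=> x /= xA i; [move=> _|]; exact: xA.
  apply: fin_bigcap_measurable => // i _.
  by rewrite -[X in measurable X]setTI; apply: (measurable_coord i) => //; exact: mA.
rewrite -(product_measure2E _ _ (mA ord0) mB).
rewrite /= /cons_measure /pushforward; congr ((_ \x^ _)%E _).
apply/seteqP; split=> [p /= pA|p [/= p1 p2] i].
  by split=> /=; [rewrite -consrV0|move=> i; rewrite -consrVS].
by case: (unliftP ord0 i) => [j ->|->]; rewrite ?consrV0 ?consrVS.
Qed.

End lebesgue_measure_rV.

Section complex_functions.
Context {R : realType} {n : nat}.
Implicit Types (f g psi : 'rV[R]_n -> R[i]) (x y w : 'rV[R]_n).

(* The norm of the normed module 'rV[R]_n is the sup norm, hence enorm. *)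
Definition dotp x y : R := \sum_(i < n) x ord0 i * y ord0 i.
Definition enorm x : R := Num.sqrt (dotp x x).

Definition cmeasurable f :=
  measurable_fun setT (fun x => complex.Re (f x)) /\
  measurable_fun setT (fun x => complex.Im (f x)).

Definition Lpnorm (p : R) f : \bar R :=
  Lnorm (lebesgue_rV n) p%:E (fun x => (Normc.normc (f x))%:E).

(* Elements of L^p are handled through Borel measurable representatives. *)
Definition memLp (p : R) f := cmeasurable f /\ (Lpnorm p f < +oo)%E.

(* Meaningful for integrable f only: the real integrals below are `fine` of the
   extended ones. *)
Definition cintegral f : R[i] :=
  (\int[lebesgue_rV n]_x complex.Re (f x)) +i*
  (\int[lebesgue_rV n]_x complex.Im (f x)).

Definition fourier f w : R[i] :=
  cintegral (fun x => f x * (cos (dotp x w) -i* sin (dotp x w))).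

Definition convol f g x : R[i] := cintegral (fun y => f (x - y) * g y).

Definition wavelet psi :=
  [/\ memLp 1 psi, memLp 2 psi & cintegral psi = 0].

Definition littlewood_paley_cont psi (C : R) :=
  0 < C /\ forall w, w != 0 ->
  (\int[lebesgue_measure]_(l in `]0%R, +oo[)
     (Normc.normc (fourier psi (l *: w)) ^+ 2 / l)%:E = C%:E)%E.

Definition littlewood_paley_dyad psi (C : R) :=
  0 < C /\ forall w, w != 0 ->
  \esum_(j in [set: int])
     (Normc.normc (fourier psi ((2 : R) ^ j *: w)) ^+ 2)%:E = C%:E.

Definition dilate_cont psi (l : R) x : R[i] :=
  (l `^ (- (n%:R / 2)))%:C * psi (l^-1 *: x).

Definition dilate_dyad psi (j : int) x : R[i] :=
  ((2 : R) ^ (- (n%:Z * j)))%:C * psi ((2 : R) ^ (- j) *: x).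

(* || ... |f * k_1| * k_2| ... | * k_m for s = [:: k_1; ...; k_m]; there is no
   modulus after the last convolution. *)
Fixpoint cascade f (s : seq ('rV[R]_n -> R[i])) : 'rV[R]_n -> R[i] :=
  match s with
  | [::] => f
  | [:: k] => convol f k
  | k :: s' => cascade (fun x => (Normc.normc (convol f k x))%:C) s'
  end.

(* Only meaningful for l in the positive orthant. *)
Definition scattering_cont psi m f (l : m.-tuple R) : \bar R :=
  Lpnorm 2 (cascade f [seq dilate_cont psi li | li <- l]).

Definition scattering_dyad psi m f (j : m.-tuple int) : \bar R :=
  Lpnorm 2 (cascade f [seq dilate_dyad psi ji | ji <- j]).

End complex_functions.

Section scattering_spaces.
Context {R : realType}.

(* The iterated integral over (0, +oo)^m against the measures dl / l^(n+1),
   the first variable being the outermost one. *)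
Fixpoint iter_integral (n m : nat) : (m.-tuple R -> \bar R) -> \bar R :=
  match m with
  | 0 => fun F => F [tuple]
  | m'.+1 => fun F =>
      (\int[lebesgue_measure]_(l in `]0%R, +oo[)
         (iter_integral n (fun t : m'.-tuple R => F [tuple of l :: t]) *
          ((l ^+ n.+1)^-1)%:E))%E
  end.

Definition sqnorm_cont (n m : nat) (F : m.-tuple R -> \bar R) : \bar R :=
  iter_integral n (fun l => `|F l| ^+ 2)%E.

Definition positive_orthant (m : nat) : set (m.-tuple R) :=
  [set l | forall i, 0 < tnth l i].

Definition memL2_cont (n m : nat) (F : m.-tuple R -> \bar R) :=
  [/\ forall l, positive_orthant l -> F l \is a fin_num,
      measurable_fun (@positive_orthant m) F & (sqnorm_cont n F < +oo)%E].

Definition sqnorm_dyad (m : nat) (F : m.-tuple int -> \bar R) : \bar R :=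
  \esum_(j in [set: m.-tuple int]) (`|F j| ^+ 2)%E.

Definition memL2_dyad (m : nat) (F : m.-tuple int -> \bar R) :=
  (forall j, F j \is a fin_num) /\ (sqnorm_dyad F < +oo)%E.

End scattering_spaces.

(* Main.v *)
(* The Plancherel identity needed for one layer is proved on step functions only.
   For f = sum c_i 1_(box i) let K = sum c_i k_i, where k_i is the explicit
   (normalized) transform of the i-th box. Then the families f(. - y) and
   e^(-i y.w) K(w), indexed by y, have the same Gram kernel: for intervals this is
   the formula int (1 - cos (t w)) / w^2 dw = const * |t|, which follows by
   scaling. Both f * g and K * ghat are superpositions of these families with
   weights g(y) dy, so they have the same L^2 norm. Integrating in the scale and
   exchanging integrals, the Littlewood-Paley condition gives
   Q(f) = C ||f||^2 for step functions f, where Q(f) is the integral of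
   ||f * psi_l||^2. Step functions are dense in L^2, so Fatou's lemma gives
   Q <= C ||.||^2, and then C ||.||^2 - Q is a nonnegative quadratic form, which
   vanishes on step functions; the parallelogram law forces it to vanish. The
   identity for m layers follows by applying this one to the functions |f * psi_l|
   successively. *)

From HB Require Import structures.
Require Import Defs.
From mathcomp Require Import all_boot all_order all_algebra.
From mathcomp Require Import all_classical all_reals all_analysis.
From mathcomp Require Import measurable_realfun complex.
From mathcomp Require Import ring lra.

Set Implicit Arguments.
Unset Strict Implicit.
Unset Printing Implicit Defensive.

Import Order.TTheory GRing.Theory Num.Theory.
Import numFieldNormedType.Exports.

Local Open Scope classical_set_scope.
Local Open Scope ring_scope.
Local Open Scope complex_scope.

(** * Complex-valued integrals *)

Section complex_numbers.
Context {R : realType}.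
Implicit Types z w : R[i].

(** The squared norm of a superposition of vectors h_y with weights g(y) is the double integral of
    <h_y, h_y'> g(y) conj(g(y')), so it depends on the family only through its Gram kernel. Families
    living in different L^2 spaces are thus compared without an isometry between these spaces, and
    the L^2 Fourier transform is never constructed. Boxes are convenient because everything factors
    over the coordinates: the overlap of two intervals is a signed sum of four distances between
    endpoints, and the real part of the product of one transform with the conjugate of the other is
    the same signed sum of kernels whose integrals are proportional to these distances. The factor
    of proportionality is pi, but only its being finite and positive matters, as the transform is
    normalized by it. Fatou's lemma bounds Q from one side only; still, this makes Q finite on all
    of L^2, and only then can the parallelogram law be solved for Q(f) and yield the opposite bound.
    The continuous and the dyadic case are one statement about a measure on the set of scales. *)

Definition sqn z : R := complex.Re z ^+ 2 + complex.Im z ^+ 2.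

Lemma sqn_ge0 z : 0 <= sqn z.
Proof. by rewrite addr_ge0// sqr_ge0. Qed.

Lemma sqr_normc z : Normc.normc z ^+ 2 = sqn z.
Proof. by case: z => a b; rewrite /= sqr_sqrtr// addr_ge0// sqr_ge0. Qed.

Lemma normc_ge0 z : 0 <= Normc.normc z.
Proof. by case: z => a b; exact: sqrtr_ge0. Qed.

Lemma ReM z w : complex.Re (z * w) =
  complex.Re z * complex.Re w - complex.Im z * complex.Im w.
Proof. by case: z => a b; case: w. Qed.

Lemma ImM z w : complex.Im (z * w) =
  complex.Re z * complex.Im w + complex.Im z * complex.Re w.
Proof. by case: z => a b; case: w => c d /=; rewrite (mulrC b). Qed.

Lemma ReJ z : complex.Re z^* = complex.Re z.
Proof. by case: z. Qed.

Lemma ImJ z : complex.Im z^* = - complex.Im z.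
Proof. by case: z. Qed.

Lemma ReD z w : complex.Re (z + w) = complex.Re z + complex.Re w.
Proof. by case: z; case: w. Qed.

Lemma ImD z w : complex.Im (z + w) = complex.Im z + complex.Im w.
Proof. by case: z; case: w. Qed.

Lemma ReN z : complex.Re (- z) = - complex.Re z.
Proof. by case: z. Qed.

Lemma ImN z : complex.Im (- z) = - complex.Im z.
Proof. by case: z. Qed.

Definition ReImE := (ReM, ImM, ReJ, ImJ, ReD, ImD, ReN, ImN).

Lemma complexP z w :
  complex.Re z = complex.Re w -> complex.Im z = complex.Im w -> z = w.
Proof. by case: z w => a b [c d] /= -> ->. Qed.

Lemma sqnM z w : sqn (z * w) = sqn z * sqn w.
Proof. by rewrite /sqn !ReImE; ring. Qed.

Lemma sqnJ z : sqn z^* = sqn z.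
Proof. by rewrite /sqn !ReImE sqrrN. Qed.

Lemma sqnN z : sqn (- z) = sqn z.
Proof. by rewrite /sqn !ReImE !sqrrN. Qed.

Lemma Re_mulJ z : complex.Re (z * z^*) = sqn z.
Proof. by rewrite !ReImE /sqn; ring. Qed.

Lemma Im_eqJ z : z = z^* -> complex.Im z = 0.
Proof. by case: z => a b [] /= bN; lra. Qed.

Lemma sqn0 : sqn 0 = 0.
Proof. by rewrite /sqn/= !expr0n/= addr0. Qed.

Lemma sqn_real (a : R) : sqn a%:C = a ^+ 2.
Proof. by rewrite /sqn/= expr0n/= addr0. Qed.

Lemma sqn_parallelogram z w :
  sqn (z + w) + sqn (z - w) = 2 * sqn z + 2 * sqn w.
Proof. by rewrite /sqn !ReImE; ring. Qed.

Lemma sqnD_le z w : sqn (z + w) <= 2 * sqn z + 2 * sqn w.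
Proof. by rewrite -sqn_parallelogram lerDl sqn_ge0. Qed.

Lemma Re_le_normc z : `|complex.Re z| <= Normc.normc z.
Proof.
rewrite -ler_sqr ?nnegrE ?normc_ge0// sqr_normc real_normK ?num_real//.
by rewrite lerDl sqr_ge0.
Qed.

Lemma Im_le_normc z : `|complex.Im z| <= Normc.normc z.
Proof.
rewrite -ler_sqr ?nnegrE ?normc_ge0// sqr_normc real_normK ?num_real//.
by rewrite lerDr sqr_ge0.
Qed.

Lemma normc_le_ReIm z : Normc.normc z <= `|complex.Re z| + `|complex.Im z|.
Proof.
rewrite -ler_sqr ?nnegrE ?normc_ge0 ?addr_ge0// sqr_normc sqrrD.
rewrite !real_normK ?num_real// /sqn -addrA lerD2l lerDr.
by rewrite mulrn_wge0// mulr_ge0.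
Qed.

(** The inequality 2ab <= a^2 + b^2. It takes the place of Cauchy-Schwarz in the integrability
    arguments below. *)
Lemma normcM_le z w :
  Normc.normc (z * w) <= (sqn z + sqn w) / 2.
Proof.
rewrite Normc.normcM -!sqr_normc ler_pdivlMr// mulr_natr.
by rewrite -subr_ge0 addrAC -sqrrB sqr_ge0.
Qed.

End complex_numbers.

Section cmeas.
Context d (T : measurableType d) (R : realType).
Implicit Types (f g : T -> R[i]) (h : T -> R).

(** The analogue of [cmeasurable] over any measurable domain; it is needed on products with a space
    of parameters. *)
Definition cmeas f :=
  measurable_fun setT (fun x => complex.Re (f x)) /\
  measurable_fun setT (fun x => complex.Im (f x)).

Lemma cmeas_cst (c : R[i]) : cmeas (fun=> c).
Proof. by split; exact: measurable_cst. Qed.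

Lemma cmeas_real h : measurable_fun setT h -> cmeas (fun x => (h x)%:C).
Proof. by move=> mh; split => //; exact: measurable_cst. Qed.

Lemma cmeasD f g : cmeas f -> cmeas g -> cmeas (fun x => f x + g x).
Proof.
move=> [f1 f2] [g1 g2]; split.
- by under eq_fun do rewrite ReD; exact: measurable_funD.
- by under eq_fun do rewrite ImD; exact: measurable_funD.
Qed.

Lemma cmeasN f : cmeas f -> cmeas (fun x => - f x).
Proof.
move=> [f1 f2]; split.
- by under eq_fun do rewrite ReN; exact: measurable_funN.
- by under eq_fun do rewrite ImN; exact: measurable_funN.
Qed.

Lemma cmeasJ f : cmeas f -> cmeas (fun x => (f x)^*).
Proof.
move=> [f1 f2]; split.
- by under eq_fun do rewrite ReJ.
- by under eq_fun do rewrite ImJ; exact: measurable_funN.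
Qed.

Lemma cmeasM f g : cmeas f -> cmeas g -> cmeas (fun x => f x * g x).
Proof.
move=> [f1 f2] [g1 g2]; split.
- under eq_fun do rewrite ReM.
  by apply: measurable_funB; exact: measurable_funM.
- under eq_fun do rewrite ImM.
  by apply: measurable_funD; exact: measurable_funM.
Qed.

Lemma cmeas_prod I (r : seq I) (F : I -> T -> R[i]) :
  (forall i, cmeas (F i)) -> cmeas (fun x => \prod_(i <- r) F i x).
Proof.
move=> mF; elim: r => [|i r IH].
  by under eq_fun do rewrite big_nil; exact: cmeas_cst.
by under eq_fun do rewrite big_cons; exact: cmeasM.
Qed.

Lemma measurable_sqn f : cmeas f -> measurable_fun setT (fun x => sqn (f x)).
Proof.
move=> [f1 f2]; rewrite /sqn.
by apply: measurable_funD; apply: (measurable_funX 2).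
Qed.

Lemma measurable_normc f :
  cmeas f -> measurable_fun setT (fun x => Normc.normc (f x)).
Proof.
move=> mf; rewrite (_ : (fun _ => _) = @Num.sqrt R \o (fun x => sqn (f x))).
  apply: measurableT_comp; last exact: measurable_sqn.
  by apply: continuous_measurable_fun; exact: sqrt_continuous.
by apply/funext => x /=; rewrite -sqr_normc sqrtr_sqr ger0_norm// normc_ge0.
Qed.

End cmeas.

Lemma cmeas_comp d1 d2 (T1 : measurableType d1) (T2 : measurableType d2)
    (R : realType) (f : T2 -> R[i]) (phi : T1 -> T2) :
  cmeas f -> measurable_fun setT phi -> cmeas (f \o phi).
Proof.
move=> [f1 f2] mphi; split.
- exact: (measurableT_comp f1 mphi).
- exact: (measurableT_comp f2 mphi).
Qed.

Section cint.
Context d (T : measurableType d) (R : realType).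
Variable mu : {measure set T -> \bar R}.
Implicit Types (f g : T -> R[i]) (h : T -> R).

Definition cintegrable f :=
  mu.-integrable setT (fun x => (complex.Re (f x))%:E) /\
  mu.-integrable setT (fun x => (complex.Im (f x))%:E).

(** [cintegral] for an arbitrary measure; for Lebesgue measure on R^n the two are convertible. *)
Definition cint f : R[i] :=
  (\int[mu]_x complex.Re (f x)) +i* (\int[mu]_x complex.Im (f x)).

Lemma Re_cintE f : complex.Re (cint f) = \int[mu]_x complex.Re (f x).
Proof. by []. Qed.

Lemma Im_cintE f : complex.Im (cint f) = \int[mu]_x complex.Im (f x).
Proof. by []. Qed.

(** The squared L^2 norm, kept as an extended real: Tonelli, Fatou and the parallelogram law apply
    to it before finiteness is known. *)
Definition energy f : \bar R := (\int[mu]_x (sqn (f x))%:E)%E.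

Definition square_integrable f := cmeas f /\ (energy f < +oo)%E.

Lemma energy_ge0 f : (0 <= energy f)%E.
Proof. by apply: integral_ge0 => x _; rewrite lee_fin sqn_ge0. Qed.

Lemma cintegrable_cmeas f : cintegrable f -> cmeas f.
Proof.
move=> [f1 f2]; split; apply/measurable_EFinP.
- exact: measurable_int f1.
- exact: measurable_int f2.
Qed.

Lemma cintegrable_le f h : cmeas f -> mu.-integrable setT (EFin \o h) ->
  (forall x, Normc.normc (f x) <= h x) -> cintegrable f.
Proof.
move=> [f1 f2] ih fh; split.
- apply: le_integrable ih => //; first exact/measurable_EFinP.
  move=> x _ /=; rewrite lee_fin (le_trans (Re_le_normc _))//.
  by rewrite (le_trans (fh _))// ler_norm.
- apply: le_integrable ih => //; first exact/measurable_EFinP.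
  move=> x _ /=; rewrite lee_fin (le_trans (Im_le_normc _))//.
  by rewrite (le_trans (fh _))// ler_norm.
Qed.

Lemma integrable_normc f : cintegrable f ->
  mu.-integrable setT (EFin \o (fun x => Normc.normc (f x))).
Proof.
move=> [f1 f2].
have := integrableD measurableT (integrable_abse f1) (integrable_abse f2).
apply: le_integrable => //.
  by apply/measurable_EFinP/measurable_normc/cintegrable_cmeas; split.
move=> x _ /=; rewrite lee_fin ger0_norm ?normc_ge0//.
by rewrite (le_trans (normc_le_ReIm _))// ler_norm.
Qed.

Lemma cintegrableP f : cintegrable f <->
  cmeas f /\ (\int[mu]_x (Normc.normc (f x))%:E < +oo)%E.
Proof.
split=> [If|[mf If]].
  split; first exact: cintegrable_cmeas.
  have /integrableP[_] := integrable_normc If.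
  by under eq_integral do rewrite /= ger0_norm ?normc_ge0//.
apply: (@cintegrable_le _ (fun x => Normc.normc (f x))) => //.
apply/integrableP; split; first exact/measurable_EFinP/measurable_normc.
by under eq_integral do rewrite /= ger0_norm ?normc_ge0//.
Qed.

Lemma cintegrableZl c f : cintegrable f -> cintegrable (fun x => c * f x).
Proof.
move=> [f1 f2]; split.
- under eq_fun do rewrite ReM EFinB !EFinM.
  by apply: integrableB => //; exact: integrableZl.
- under eq_fun do rewrite ImM EFinD !EFinM.
  by apply: integrableD => //; exact: integrableZl.
Qed.

Lemma cintegrableJ f : cintegrable f -> cintegrable (fun x => (f x)^*).
Proof.
move=> [f1 f2]; split.
- by under eq_fun do rewrite ReJ.
- by under eq_fun do rewrite ImJ EFinN; exact: integrableN.
Qed.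

Lemma integrableZl_EFin (k : R) h : mu.-integrable setT (EFin \o h) ->
  mu.-integrable setT (EFin \o (fun x => k * h x)).
Proof.
move=> Ih; rewrite (_ : _ \o _ = (fun x => k%:E * (EFin \o h) x)%E).
  exact: integrableZl.
by apply/funext => x /=; rewrite EFinM.
Qed.

Lemma cintegrable0 : cintegrable (fun=> 0).
Proof. by split; exact: integrable0. Qed.

Lemma cint0 : cint (fun=> 0) = 0.
Proof.
by apply: complexP; rewrite /= /Rintegral integral0.
Qed.

Lemma cintD f g : cintegrable f -> cintegrable g ->
  cint (fun x => f x + g x) = cint f + cint g.
Proof.
move=> [f1 f2] [g1 g2]; apply: complexP; rewrite !ReImE /=.
- by under eq_Rintegral do rewrite ReD; rewrite RintegralD.
- by under eq_Rintegral do rewrite ImD; rewrite RintegralD.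
Qed.

Lemma cintZl c f : cintegrable f -> cint (fun x => c * f x) = c * cint f.
Proof.
move=> [f1 f2]; apply: complexP; rewrite !ReImE /=.
- under eq_Rintegral do rewrite ReM.
  by rewrite RintegralB// ?RintegralZl//; exact: integrableZl_EFin.
- under eq_Rintegral do rewrite ImM.
  by rewrite RintegralD// ?RintegralZl//; exact: integrableZl_EFin.
Qed.

Lemma cintN f : cintegrable f -> cint (fun x => - f x) = - cint f.
Proof.
move=> If; rewrite -mulN1r -cintZl//; congr cint.
by apply/funext => x; rewrite mulN1r.
Qed.

(** [cint] is built from [fine]; integrability is what allows the extended integral to be recovered
    from it. *)
Lemma Re_cint f : cintegrable f ->
  (\int[mu]_x (complex.Re (f x))%:E = (complex.Re (cint f))%:E)%E.
Proof. by move=> [f1 f2]; rewrite /= fineK//; exact: integrable_fin_num. Qed.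

Lemma cintJ f : cintegrable f -> cint (fun x => (f x)^*) = (cint f)^*.
Proof.
move=> [f1 f2]; apply: complexP; rewrite !ReImE /=.
- by under eq_Rintegral do rewrite ReJ.
- under eq_Rintegral do rewrite ImJ -mulN1r.
  by rewrite RintegralZl// mulN1r.
Qed.

Lemma square_integrableP f : square_integrable f <->
  cmeas f /\ mu.-integrable setT (EFin \o (fun x => sqn (f x))).
Proof.
split=> -[mf If]; split=> //.
  apply/integrableP; split; first exact/measurable_EFinP/measurable_sqn.
  by under eq_integral do rewrite /= ger0_norm ?sqn_ge0//.
have /integrableP[_] := If.
by under eq_integral do rewrite /= ger0_norm ?sqn_ge0//.
Qed.

Lemma square_integrable_mul f g : square_integrable f -> square_integrable g ->
  cintegrable (fun x => f x * g x).
Proof.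
move=> /square_integrableP[mf If] /square_integrableP[mg Ig].
apply: (@cintegrable_le _ (fun x => (sqn (f x) + sqn (g x)) / 2)).
- exact: cmeasM.
- have := integrableZr measurableT 2^-1 (integrableD measurableT If Ig).
  by apply: eq_integrable => // x _; rewrite /= EFinM.
- by move=> x; exact: normcM_le.
Qed.

Lemma square_integrableD f g : square_integrable f -> square_integrable g ->
  square_integrable (fun x => f x + g x).
Proof.
move=> /square_integrableP[mf If] /square_integrableP[mg Ig].
apply/square_integrableP; split; first exact: cmeasD.
have := integrableD measurableT (integrableZl measurableT 2 If)
  (integrableZl measurableT 2 Ig).
apply: le_integrable => //.
  by apply/measurable_EFinP/measurable_sqn; exact: cmeasD.
move=> x _ /=; rewrite lee_fin !ger0_norm ?sqn_ge0//; first exact: sqnD_le.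
by rewrite addr_ge0// mulr_ge0// sqn_ge0.
Qed.

Lemma energyZl c f : cmeas f ->
  energy (fun x => c * f x) = ((sqn c)%:E * energy f)%E.
Proof.
move=> mf; rewrite /energy; under eq_integral do rewrite sqnM EFinM.
rewrite ge0_integralZl//.
- exact/measurable_EFinP/measurable_sqn.
- by move=> x _; rewrite lee_fin sqn_ge0.
- by rewrite lee_fin sqn_ge0.
Qed.

Lemma square_integrableZl c f : square_integrable f ->
  square_integrable (fun x => c * f x).
Proof.
move=> [mf If]; split; first by apply: cmeasM => //; exact: cmeas_cst.
by rewrite energyZl// lte_mul_pinfty// lee_fin sqn_ge0.
Qed.

Lemma square_integrable0 : square_integrable (fun=> 0).
Proof.
split; first exact: cmeas_cst.
by rewrite /energy; under eq_integral do rewrite sqn0; rewrite integral0.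
Qed.

Lemma energyN f : energy (fun x => - f x) = energy f.
Proof. by rewrite /energy; under eq_integral do rewrite sqnN. Qed.

Lemma square_integrableN f : square_integrable f ->
  square_integrable (fun x => - f x).
Proof. by move=> [mf If]; split; [exact: cmeasN|rewrite energyN]. Qed.

Lemma square_integrableJ f : square_integrable f ->
  square_integrable (fun x => (f x)^*).
Proof.
move=> [mf If]; split; first exact: cmeasJ.
by rewrite /energy; under eq_integral do rewrite sqnJ.
Qed.

Lemma energy_parallelogram f g : cmeas f -> cmeas g ->
  (energy (fun x => f x + g x)%R + energy (fun x => f x - g x)%R =
   2%:E * energy f + 2%:E * energy g)%E.
Proof.
move=> mf mg.
have ms (u : T -> R[i]) : cmeas u -> measurable_fun setT (fun x => (sqn (u x))%:E).
  by move=> mu0; exact/measurable_EFinP/measurable_sqn.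
have s0 (u : T -> R[i]) x : setT x -> (0 <= (sqn (u x))%:E)%E.
  by move=> _; rewrite lee_fin sqn_ge0.
rewrite /energy -!ge0_integralZl//; try exact: ms; try exact: s0.
rewrite -!ge0_integralD//.
- by apply: eq_integral => x _; rewrite -!EFinM -!EFinD sqn_parallelogram.
- by move=> x _; rewrite mule_ge0 ?s0.
- by apply: measurable_funeM; exact: ms.
- by move=> x _; rewrite mule_ge0 ?s0.
- by apply: measurable_funeM; exact: ms.
- exact: s0.
- by apply: ms; exact: cmeasD.
- exact: s0.
- by apply: ms; apply: cmeasD => //; exact: cmeasN.
Qed.

(** A substitute for the triangle inequality, obtained by dropping one term of the parallelogram
    law. The factor 2 is harmless in approximation arguments. *)
Lemma energyD_le f g : cmeas f -> cmeas g ->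
  (energy (fun x => f x + g x)%R <= 2%:E * energy f + 2%:E * energy g)%E.
Proof.
by move=> mf mg; rewrite -energy_parallelogram// leeDl// energy_ge0.
Qed.

End cint.

(** * Superpositions and Gram kernels *)

Section prod_measure.
Context d1 d2 (X : measurableType d1) (Y : measurableType d2) (R : realType).
Variable m1 : {sigma_finite_measure set X -> \bar R}.
Variable m2 : {sigma_finite_measure set Y -> \bar R}.

(* The sigma-finite instance of [\x] is shadowed by its subprobability one. *)
Definition prod_measure : set (X * Y)%type -> \bar R := (m1 \x m2)%E.

HB.instance Definition _ := Measure.on prod_measure.

Lemma prod_measure_sigma_finite : sigma_finite setT prod_measure.
Proof.
have /sigma_finiteP[F [TF ndF Foo]] := sigma_finiteT m1.
have /sigma_finiteP[G [TG ndG Goo]] := sigma_finiteT m2.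
(* Both exhaustions are nondecreasing, so the diagonal products already cover the whole space. *)
exists (fun n => F n `*` G n).
  apply/seteqP; split=> // -[x y] _.
  have [i _ Fx] : (\bigcup_n F n) x by rewrite -TF.
  have [j _ Gy] : (\bigcup_n G n) y by rewrite -TG.
  exists (maxn i j) => //; split => /=.
  - by have /subsetPset := ndF _ _ (leq_maxl i j); exact.
  - by have /subsetPset := ndG _ _ (leq_maxr i j); exact.
move=> n; have [mFn Fn] := Foo n; have [mGn Gn] := Goo n.
split; first exact: measurableX.
rewrite /prod_measure product_measure1E//.
by apply: lte_mul_pinfty => //; rewrite ge0_fin_numE.
Qed.

HB.instance Definition _ :=
  Measure_isSigmaFinite.Build _ _ _ prod_measure prod_measure_sigma_finite.

End prod_measure.

Section product_integrals.
Context d1 d2 (X : measurableType d1) (Y : measurableType d2) (R : realType).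
Variable m1 : {sigma_finite_measure set X -> \bar R}.
Variable m2 : {sigma_finite_measure set Y -> \bar R}.

Lemma integrable_prod (u : X -> R) (v : Y -> R) :
  m1.-integrable setT (EFin \o u) -> m2.-integrable setT (EFin \o v) ->
  (prod_measure m1 m2).-integrable setT (EFin \o (fun p => u p.1 * v p.2)) /\
  \int[(prod_measure m1 m2)]_p (u p.1 * v p.2) = (\int[m1]_x u x) * (\int[m2]_y v y).
Proof.
move=> Iu Iv.
have mu : measurable_fun setT u by apply/measurable_EFinP; exact: measurable_int Iu.
have mv : measurable_fun setT v by apply/measurable_EFinP; exact: measurable_int Iv.
have mF : measurable_fun setT (EFin \o (fun p : X * Y => u p.1 * v p.2)).
  apply/measurable_EFinP; apply: measurable_funM.
  - exact: measurableT_comp.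
  - exact: measurableT_comp.
have IF : (prod_measure m1 m2).-integrable setT (EFin \o (fun p => u p.1 * v p.2)).
  apply/(integrable12ltyP m1 m2 mF) => /=.
  under eq_integral do under eq_integral do rewrite normrM EFinM.
  have /integrableP[_] := Iv => /= Iv'.
  have /integrableP[_] := Iu => /= Iu'.
  under eq_integral => x _.
    rewrite ge0_integralZl//; last by apply/measurable_EFinP; exact: measurableT_comp.
    over.
  rewrite ge0_integralZr//; last 2 first.
  - by apply/measurable_EFinP; exact: measurableT_comp.
  - by apply: integral_ge0.
  apply: lte_mul_pinfty => //; first exact: integral_ge0.
  by rewrite ge0_fin_numE//; exact: integral_ge0.
split=> //; rewrite /Rintegral.
rewrite -(integral12_prod_meas1 IF) /=.
under eq_integral => x _.
  rewrite (_ : fubini_F _ _ _ = (u x)%:E * \int[m2]_y (v y)%:E)%E; last first.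
    rewrite /fubini_F /=; under eq_integral do rewrite EFinM.
    by rewrite integralZl.
  over.
have vfin : (\int[m2]_y (v y)%:E)%E \is a fin_num by exact: integrable_fin_num.
have ufin : (\int[m1]_y (u y)%:E)%E \is a fin_num by exact: integrable_fin_num.
rewrite -(fineK vfin) integralZr//= fineM//.
Qed.

Lemma cintegrable_prod (u : X -> R[i]) (v : Y -> R[i]) :
  cintegrable m1 u -> cintegrable m2 v ->
  cintegrable (prod_measure m1 m2) (fun p => u p.1 * v p.2) /\
  cint (prod_measure m1 m2) (fun p => u p.1 * v p.2) = cint m1 u * cint m2 v.
Proof.
move=> [u1 u2] [v1 v2].
have [I11 E11] := integrable_prod u1 v1.
have [I12 E12] := integrable_prod u1 v2.
have [I21 E21] := integrable_prod u2 v1.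
have [I22 E22] := integrable_prod u2 v2.
split.
  split; [under eq_fun do rewrite ReM EFinB|under eq_fun do rewrite ImM EFinD].
  - exact: integrableB I11 I22.
  - exact: integrableD I12 I21.
apply: complexP; rewrite ?ReM ?ImM ?Re_cintE ?Im_cintE.
- by under eq_Rintegral do rewrite ReM; rewrite RintegralB// E11 E22.
- by under eq_Rintegral do rewrite ImM; rewrite RintegralD// E12 E21.
Qed.

End product_integrals.

Section superposition.
Context d1 d2 (X : measurableType d1) (Y : measurableType d2) (R : realType).
Variable m1 : {sigma_finite_measure set X -> \bar R}.
Variable m2 : {sigma_finite_measure set Y -> \bar R}.
Variables (h : X * Y -> R[i]) (g : Y -> R[i]) (M : R).
Hypothesis mh : cmeas h.
Hypothesis Ig : cintegrable m2 g.
Hypothesis hM : forall y, (energy m1 (fun x => h (x, y)) <= M%:E)%E.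
Hypothesis Ihg : forall x, cintegrable m2 (fun y => h (x, y) * g y).

Let a x y := h (x, y) * g y.
(** The integrand obtained by expanding the square of a superposition at the point x; y and y' are
    its two integration variables. *)
Let F (z : X * (Y * Y)) : R := complex.Re (a z.1 z.2.1 * (a z.1 z.2.2)^*).

Let mF : measurable_fun setT (EFin \o F).
Proof.
have ma (phi : X * (Y * Y) -> Y) : measurable_fun setT phi ->
    cmeas (fun z : X * (Y * Y) => a z.1 (phi z)).
  move=> mphi; apply: cmeasM.
  - apply: (cmeas_comp (phi := fun z => (z.1, phi z)) mh).
    exact: measurable_fun_pair.
  - exact: (cmeas_comp (cintegrable_cmeas Ig) mphi).
apply/measurable_EFinP.
have [] : cmeas (fun z => a z.1 z.2.1 * (a z.1 z.2.2)^*) => //.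
by apply: cmeasM; [|apply: cmeasJ]; apply: ma; exact: measurableT_comp.
Qed.

Let mhy y : cmeas (fun x => h (x, y)).
Proof. by apply: (cmeas_comp mh); exact: measurable_pair2. Qed.

(** As 2 |h(x,y) h(x,y')| <= |h(x,y)|^2 + |h(x,y')|^2, integrating |F| in x leaves at most M |g(y)|
    |g(y')|, which is integrable on Y x Y. *)
Let IF : (m1 \x prod_measure m2 m2)%E.-integrable setT (EFin \o F).
Proof.
apply/(integrable21ltyP m1 (prod_measure m2 m2) mF).
have [mg Ng] := (cintegrableP m2 g).1 Ig.
pose ng y := Normc.normc (g y).
have Ing : m2.-integrable setT (EFin \o ng) by exact: integrable_normc.
have [Igg _] := integrable_prod Ing Ing.
have /integrableP[mgg] := integrableZl measurableT M Igg.
apply: le_lt_trans; apply: ge0_le_integral => //.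
- by move=> p _; exact: integral_ge0.
- apply: (measurable_fun_fubini_tonelli_G (abse \o (EFin \o F))) => //.
    exact: (measurableT_comp (@abse_measurable _ _) mF).
  by move=> x; exact: abse_ge0.
- exact: (measurableT_comp (@abse_measurable _ _) mgg).
move=> [y y'] _ /=.
pose s z x := sqn (h (x, z)).
have ms z : measurable_fun setT (fun x => (s z x)%:E).
  by apply/measurable_EFinP/measurable_sqn/mhy.
have s0 z x : (0 <= (s z x)%:E)%E by rewrite lee_fin sqn_ge0.
have M0 : 0 <= M by rewrite -lee_fin (le_trans _ (hM y))// energy_ge0.
rewrite (ger0_norm (_ : 0 <= M * _)) ?mulr_ge0 ?normc_ge0//.
apply: (@le_trans _ _
    (\int[m1]_x ((ng y * ng y' / 2)%:E * ((s y x)%:E + (s y' x)%:E)))%E).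
  apply: ge0_le_integral => //.
  - apply/measurable_EFinP; apply: measurableT_comp => //.
    have /measurable_EFinP mF' := mF.
    exact: (measurableT_comp mF' (measurable_pair2 (y, y'))).
  - by apply: measurable_funeM; exact: emeasurable_funD.
  move=> x _; rewrite -EFinD -EFinM lee_fin /F /=.
  rewrite (le_trans (Re_le_normc _))//.
  rewrite (_ : a x y * _ = (g y * (g y')^*) * (h (x, y) * (h (x, y'))^*)); last first.
    by rewrite /a rmorphM/=; ring.
  rewrite Normc.normcM Normc.normcM.
  have -> : Normc.normc (g y')^* = ng y'.
    by rewrite /ng; case: (g y') => ? ? /=; rewrite sqrrN.
  rewrite -/(ng y) -[leRHS]mulrA ler_wpM2l ?mulr_ge0 ?normc_ge0//.
  by rewrite (le_trans (normcM_le _ _))// sqnJ mulrC.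
rewrite ge0_integralZl//; last 3 first.
- exact: emeasurable_funD.
- by move=> x _; rewrite adde_ge0.
- by rewrite lee_fin !mulr_ge0 ?normc_ge0.
rewrite ge0_integralD//.
rewrite (@le_trans _ _ ((ng y * ng y' / 2)%:E * (M%:E + M%:E))%E)//.
  by rewrite lee_wpmul2l ?lee_fin ?mulr_ge0 ?normc_ge0// leeD//; exact: hM.
by rewrite -EFinD -EFinM lee_fin le_eqVlt; apply/orP; left; apply/eqP; field.
Qed.

(** The square is expanded and the integrals are exchanged. On the right, h enters only through the
    inner products of its sections at [p.1] and [p.2]. *)
Lemma superposition_energy :
  energy m1 (fun x => cint m2 (fun y => h (x, y) * g y)) =
  (\int[(prod_measure m2 m2)]_p \int[m1]_x
     (complex.Re (h (x, p.1) * g p.1 * (h (x, p.2) * g p.2)^*)%R)%:E)%E.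
Proof.
rewrite -[RHS]/(\int[(prod_measure m2 m2)]_p \int[m1]_x ((EFin \o F) (x, p)))%E.
rewrite (integral21_prod_meas1 IF) -(integral12_prod_meas1 IF).
apply: eq_integral => x _; rewrite /fubini_F/=.
have [I E] := cintegrable_prod (Ihg x) (cintegrableJ (Ihg x)).
transitivity (complex.Re (cint (prod_measure m2 m2)
  (fun p => h (x, p.1) * g p.1 * (h (x, p.2) * g p.2)^*)))%:E.
  rewrite E cintJ//; congr (_%:E).
  by rewrite !ReImE /sqn; ring.
by rewrite -Re_cint.
Qed.

(** Plays the role of Young's inequality: a superposition of uniformly bounded vectors of L^2 with
    integrable weights stays in L^2. *)
Lemma superposition_energy_lty :
  (energy m1 (fun x => cint m2 (fun y => h (x, y) * g y)%R) < +oo)%E.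
Proof.
rewrite superposition_energy.
rewrite -[ltLHS]/(\int[(prod_measure m2 m2)]_p \int[m1]_x ((EFin \o F) (x, p)))%E.
rewrite (integral21_prod_meas1 IF).
by have := integrable_fin_num measurableT IF; rewrite fin_numElt => /andP[].
Qed.

End superposition.

Section gram.
Context d0 d1 d2 (Y : measurableType d0) (X1 : measurableType d1)
  (X2 : measurableType d2) (R : realType).
Variable m0 : {sigma_finite_measure set Y -> \bar R}.
Variable m1 : {sigma_finite_measure set X1 -> \bar R}.
Variable m2 : {sigma_finite_measure set X2 -> \bar R}.

Lemma Re_cint_superposition d (X : measurableType d)
    (m : {measure set X -> \bar R}) (u v : X -> R[i]) (a b : R[i]) :
  square_integrable m u -> square_integrable m v ->
  (\int[m]_x (complex.Re (u x * a * (v x * b)^*)%R)%:E)%E =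
  (complex.Re (a * b^* * cint m (fun x => u x * (v x)^*)))%:E.
Proof.
move=> Iu Iv; have I := square_integrable_mul Iu (square_integrableJ Iv).
rewrite -cintZl// -Re_cint; last exact: cintegrableZl.
by apply: eq_integral => x _; rewrite rmorphM/= mulrACA (mulrC (a * _)).
Qed.

(** Both energies are the same double integral against g(y) conj(g(y')), since the families share
    their Gram kernel. The underlying spaces X1 and X2 need not be related. *)
Lemma gram_energy (h1 : X1 * Y -> R[i]) (h2 : X2 * Y -> R[i]) (g : Y -> R[i])
    (M1 M2 : R) :
  cmeas h1 -> cmeas h2 -> cintegrable m0 g ->
  (forall y, (energy m1 (fun x => h1 (x, y)) <= M1%:E)%E) ->
  (forall y, (energy m2 (fun x => h2 (x, y)) <= M2%:E)%E) ->
  (forall x, cintegrable m0 (fun y => h1 (x, y) * g y)) ->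
  (forall x, cintegrable m0 (fun y => h2 (x, y) * g y)) ->
  (forall y y', cint m1 (fun x => h1 (x, y) * (h1 (x, y'))^*) =
                cint m2 (fun x => h2 (x, y) * (h2 (x, y'))^*)) ->
  energy m1 (fun x => cint m0 (fun y => h1 (x, y) * g y)) =
  energy m2 (fun x => cint m0 (fun y => h2 (x, y) * g y)).
Proof.
move=> mh1 mh2 Ig M1h M2h I1 I2 H.
rewrite (superposition_energy mh1 Ig M1h I1) (superposition_energy mh2 Ig M2h I2).
apply: eq_integral => -[y y'] _ /=.
have S1 z : square_integrable m1 (fun x => h1 (x, z)).
  split; last exact: le_lt_trans (M1h z) (ltry _).
  by apply: (cmeas_comp mh1); exact: measurable_pair2.
have S2 z : square_integrable m2 (fun x => h2 (x, z)).
  split; last exact: le_lt_trans (M2h z) (ltry _).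
  by apply: (cmeas_comp mh2); exact: measurable_pair2.
by rewrite !Re_cint_superposition// H.
Qed.

End gram.

(** * Lebesgue measure on R^n *)

Section lebesgue_R.
Context {R : realType}.
Local Notation mu := (@lebesgue_measure R).

Lemma measurable_affine (c t : R) :
  measurable_fun setT (fun x : R => c * x + t).
Proof. by apply: measurable_funD => //; exact: measurable_funM. Qed.

(** The right-hand side is a measure in A, so uniqueness leaves only half-open intervals to check.
    For c < 0 the preimage has its closed end on the other side, which does not change its
    length. *)
Lemma lebesgue_measure_affine (c t : R) (A : set (measurableTypeR R)) :
  c != 0 -> measurable A ->
  mu A = (`|c|%:E * mu ((fun x : R => c * x + t)%R @^-1` A))%E.
Proof.
move=> c0 mA.
pose phi : measurableTypeR R -> measurableTypeR R := fun x : R => c * x + t.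
have mphi : measurable_fun setT phi by exact: measurable_affine.
pose m : {measure set (measurableTypeR R) -> \bar R} :=
  mscale (NngNum (normr_ge0 c)) 
    (measure_function_pushforward__canonical__measure_function_Measure mu mphi).
rewrite -[RHS]/(m A); apply: lebesgue_measure_unique => // _ [[a b] _ <-].
rewrite /m /= /mscale /= /pushforward.
have [ab|ab] := leP b a.
  by rewrite set_itv_ge ?bnd_simp -?leNgt// preimage_set0 !measure0 mule0.
have [c_gt0|c_lt0] : (0 < c) \/ (c < 0) by apply/orP; rewrite -neq_lt eq_sym.
- rewrite (_ : phi @^-1` _ = `](a - t) / c, (b - t) / c]%classic); last first.
    apply/seteqP; split=> x /=; rewrite !in_itv/= /phi.
    + by rewrite ltr_pdivrMr// ler_pdivlMr// ltrBlDr lerBrDr (mulrC x).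
    + by rewrite ltr_pdivrMr// ler_pdivlMr// ltrBlDr lerBrDr (mulrC x).
  rewrite !lebesgue_measure_itv/= !lte_fin ab ltr_pM2r ?invr_gt0// ltrD2r ab.
  by rewrite -!EFinD -EFinM gtr0_norm//; congr (_%:E); field.
- rewrite (_ : phi @^-1` _ = `[(b - t) / c, (a - t) / c[%classic); last first.
    apply/seteqP; split=> x /=; rewrite !in_itv/= /phi.
    + rewrite ltr_ndivlMr// ler_ndivrMr// ltrBlDr lerBrDr (mulrC x).
      by move=> /andP[-> ->].
    + rewrite ltr_ndivlMr// ler_ndivrMr// ltrBlDr lerBrDr (mulrC x).
      by move=> /andP[-> ->].
  rewrite !lebesgue_measure_itv/= !lte_fin ab ltr_nM2r ?invr_lt0// ltrD2r ab.
  by rewrite -!EFinD -EFinM ltr0_norm//; congr (_%:E); field.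
Qed.

End lebesgue_R.

Section lebesgue_rV_theory.
Context {R : realType}.
Variable n : nat.
Local Notation V := 'rV[R]_n.
Implicit Types (a b : V).

(* A copy of [lebesgue_rV n], to which a sigma-finite instance can be attached. *)
Definition leb : set V -> \bar R := lebesgue_rV n.

HB.instance Definition _ := Measure.copy leb (lebesgue_rV n).

Definition box a b : set V := [set x | forall i, x ord0 i \in `]a ord0 i, b ord0 i]].

Definition boxes : set (set V) := [set B | exists a b, B = box a b].

Definition cube (k : nat) : set V := box (const_mx (- k%:R)) (const_mx k%:R).

Lemma measurable_rectangle (A : 'I_n -> set R) : (forall i, measurable (A i)) ->
  measurable [set x : V | forall i, A i (x ord0 i)].
Proof.
move=> mA; rewrite (_ : [set x | _] =
    \bigcap_(i in [set: 'I_n]) ((fun x : V => x ord0 i) @^-1` A i)); last first.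
  by apply/seteqP; split=> x /= xA i; [move=> _|]; exact: xA.
apply: fin_bigcap_measurable => // i _.
by rewrite -[X in measurable X]setTI; apply: measurable_coord.
Qed.

Lemma measurable_box a b : measurable (box a b).
Proof.
apply: (@measurable_rectangle (fun i => [set` `]a ord0 i, b ord0 i]])).
by move=> i; exact: measurable_itv.
Qed.

Lemma leb_rectangle (A : 'I_n -> set R) : (forall i, measurable (A i)) ->
  leb [set x | forall i, A i (x ord0 i)] =
  (\prod_(i < n) lebesgue_measure (A i))%E.
Proof. exact: lebesgue_rV_box. Qed.

Lemma leb_box a b : leb (box a b) =
  (\prod_(i < n) lebesgue_measure `](a ord0 i), (b ord0 i)]%classic)%E.
Proof.
by apply: (@lebesgue_rV_box R n (fun i => [set` `]a ord0 i, b ord0 i]])) => i;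
  exact: measurable_itv.
Qed.

Lemma boxI a b c d : box a b `&` box c d =
  box (\row_i Num.max (a ord0 i) (c ord0 i)) (\row_i Num.min (b ord0 i) (d ord0 i)).
Proof.
apply/seteqP; split=> x /=.
- move=> [xab xcd] i; have := xab i; have := xcd i.
  by rewrite !in_itv/= !mxE gt_max le_min => /andP[-> ->] /andP[-> ->].
- move=> xI; split=> i; have := xI i;
  by rewrite !in_itv/= !mxE gt_max le_min => /andP[/andP[? ?] /andP[? ?]]; apply/andP.
Qed.

Lemma boxes_setI : setI_closed boxes.
Proof.
by move=> _ _ [a [b ->]] [c [d ->]]; rewrite boxI; eexists; eexists.
Qed.

Lemma norm_coord_bound (x : V) : exists k : nat, forall i, `|x ord0 i| < k%:R.
Proof.
exists (Num.bound (\sum_(i < n) `|x ord0 i|)) => i.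
apply: le_lt_trans (archi_boundP _); last by rewrite sumr_ge0.
by rewrite (bigD1 i)//= lerDl sumr_ge0.
Qed.

Lemma bigcup_cube : \bigcup_k cube k = setT.
Proof.
apply/seteqP; split=> // x _; have [k xk] := norm_coord_bound x.
exists k => // i; rewrite in_itv/= !mxE.
by have := xk i; rewrite ltr_norml => /andP[-> /ltW].
Qed.

Lemma subset_cube k l : (k <= l)%N -> cube k `<=` cube l.
Proof.
move=> kl x xk i; have := xk i; rewrite !in_itv/= !mxE => /andP[kx xl].
have {}kl : k%:R <= l%:R :> R by rewrite ler_nat.
by rewrite (le_lt_trans _ kx) ?lerN2//= (le_trans xl).
Qed.

Lemma leb_box_lty a b : (leb (box a b) < +oo)%E.
Proof.
rewrite leb_box; under eq_bigr do rewrite lebesgue_measure_itv/=.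
rewrite (eq_bigr (fun i => (Num.max 0 (b ord0 i - a ord0 i))%:E)).
  by rewrite prodEFin ltry.
move=> i _; rewrite lte_fin; case: ltP => ab.
  by rewrite -EFinD; congr (_%:E); rewrite max_r// subr_ge0 ltW.
by congr (_%:E); rewrite max_l// subr_le0.
Qed.

Lemma leb_sigma_finite : sigma_finite setT leb.
Proof.
exists cube; first by rewrite bigcup_cube.
by move=> k; split; [exact: measurable_box|exact: leb_box_lty].
Qed.

HB.instance Definition _ :=
  Measure_isSigmaFinite.Build _ _ _ leb leb_sigma_finite.

(** For the nontrivial inclusion, each half-space x_i > r is a countable union of boxes, obtained by
    cutting it with the cubes; hence the coordinates are measurable for the sigma-algebra of the
    boxes. *)
Lemma measurable_boxes : @measurable _ V = <<s boxes >>.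
Proof.
apply/seteqP; split; last first.
  apply: smallest_sub; first exact: sigma_algebra_measurable.
  by move=> _ [a [b ->]]; exact: measurable_box.
have mid : measurable_fun setT (fun x : g_sigma_algebraType boxes => (x : V)).
  apply/measurable_fun_coordP => i.
  apply: (@measurability _ _ _ _ setT _ (@RGenOInfty.G R)).
    exact: RGenOInfty.measurableE.
  move=> _ [_ [r ->] <-].
  rewrite setTI (_ : _ @^-1` _ = \bigcup_k
      box (\row_j if j == i then Num.max r (- k%:R) else - k%:R) (const_mx k%:R)); last first.
    apply/seteqP; split=> [x /=|x [k _] /(_ i) /=]; rewrite !in_itv/= ?andbT.
      move=> rx; have [k xk] := norm_coord_bound x.
      exists k => // j; rewrite in_itv/= !mxE.
      have := xk j; rewrite ltr_norml => /andP[kx /ltW ->]; rewrite andbT.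
      by case: eqP => [ji|_//]; rewrite gt_max kx ji rx.
    by rewrite !mxE eqxx gt_max => /andP[/andP[-> _] _].
  apply: bigcupT_measurable => k; apply: sub_sigma_algebra.
  by eexists; eexists.
by move=> A mA; have := mid measurableT A mA; rewrite setTI.
Qed.

Lemma measurable_affine_rV (c : R) (t : V) :
  measurable_fun setT (fun x : V => c *: x + t).
Proof.
apply/measurable_fun_coordP => i.
under eq_fun do rewrite mxE mxE.
have := measurableT_comp (measurable_affine c (t ord0 i)) (measurable_coord i).
exact.
Qed.

(** Uniqueness of the measure reduces this to boxes, where it is a product of the one-dimensional
    formulas. For c < 0 the preimage of a box is no longer half-open on the same side, hence the
    recourse to [leb_rectangle]. *)
Lemma leb_affine (c : R) (t : V) (A : set V) : c != 0 -> measurable A ->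
  leb A = ((`|c| ^+ n)%:E * leb ((fun x => c *: x + t)%R @^-1` A))%E.
Proof.
move=> c0 mA.
pose phi x := c *: x + t.
have mphi : measurable_fun setT phi by exact: measurable_affine_rV.
have cn : 0 <= `|c| ^+ n by rewrite exprn_ge0.
pose m : {measure set V -> \bar R} := mscale (NngNum cn) 
    (measure_function_pushforward__canonical__measure_function_Measure leb mphi).
rewrite -[RHS]/(m A).
apply: (measure_unique boxes cube) => //.
- exact: measurable_boxes.
- exact: boxes_setI.
- by move=> k; eexists; eexists.
- exact: bigcup_cube.
- move=> _ [a [b ->]]; rewrite -[LHS]/(leb _) leb_box.
  rewrite (eq_bigr _ (fun i _ =>
    lebesgue_measure_affine (t ord0 i) c0 (measurable_itv _))).
  rewrite /m /= /mscale /= /pushforward.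
  have -> : leb (phi @^-1` box a b) = (\prod_(i < n) lebesgue_measure
      ((fun x : R => c * x + t ord0 i)%R @^-1` `]a ord0 i, b ord0 i]))%E.
    rewrite -leb_rectangle => [|i].
      by congr leb; apply/seteqP; split=> x /= xab i; have := xab i; rewrite !mxE.
    rewrite -[X in measurable X]setTI.
    by apply: measurable_affine => //; exact: measurable_itv.
  rewrite big_split/= prodEFin; congr (_ * _)%E.
  by rewrite prodr_const card_ord.
- by move=> k; exact: leb_box_lty.
Qed.

End lebesgue_rV_theory.
Arguments leb {R} n.

Section cint_measure_change.
Context d (T : measurableType d) (R : realType).
Variables m1 m2 : {measure set T -> \bar R}.
Hypothesis m12 : forall A, measurable A -> m1 A = m2 A.

Lemma eq_measure_cintegrable f : cintegrable m1 f -> cintegrable m2 f.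
Proof.
have H (u : T -> \bar R) : m1.-integrable setT u -> m2.-integrable setT u.
  move=> /integrableP[mu Iu]; apply/integrableP; split => //.
  by rewrite (@eq_measure_integral _ _ _ _ m1)// => A mA _; rewrite m12.
by move=> [f1 f2]; split; exact: H.
Qed.

Lemma eq_measure_cint f : cint m1 f = cint m2 f.
Proof.
by apply: complexP; rewrite /= /Rintegral; congr fine;
  apply: eq_measure_integral => A mA _; exact: m12.
Qed.

End cint_measure_change.

Section cint_pushforward.
Context d1 d2 (X : measurableType d1) (Y : measurableType d2) (R : realType).
Variables (mu : {measure set X -> \bar R}) (phi : X -> Y).
Hypothesis mphi : measurable_fun setT phi.

Definition image_measure : {measure set Y -> \bar R} :=
  measure_function_pushforward__canonical__measure_function_Measure mu mphi.

Lemma cintegrable_image (f : Y -> R[i]) : cmeas f ->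
  cintegrable mu (f \o phi) -> cintegrable image_measure f.
Proof.
move=> [f1 f2] [i1 i2]; split; apply: integrable_pushforward => //;
  exact/measurable_EFinP.
Qed.

Lemma cint_image (f : Y -> R[i]) : cmeas f ->
  cintegrable mu (f \o phi) -> cint image_measure f = cint mu (f \o phi).
Proof.
move=> [f1 f2] [i1 i2]; apply: complexP; rewrite /= /Rintegral; congr fine;
  rewrite integral_pushforward//; exact/measurable_EFinP.
Qed.

End cint_pushforward.

Section affine_change_of_variables.
Context {R : realType}.
Variables (n : nat) (c : R) (t : 'rV[R]_n).
Hypothesis c0 : c != 0.
Local Notation phi := (fun x : 'rV[R]_n => c *: x + t).
Local Notation mphi := (measurable_affine_rV c t).

Lemma ge0_integral_affine (f : 'rV[R]_n -> \bar R) :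
  measurable_fun setT f -> (forall x, (0 <= f x)%E) ->
  (\int[leb n]_x f x = (`|c| ^+ n)%:E * \int[leb n]_x f (c *: x + t)%R)%E.
Proof.
move=> mf f0.
have cn : 0 <= `|c| ^+ n by rewrite exprn_ge0.
rewrite (@eq_measure_integral _ _ _ _
    (mscale (NngNum cn) (image_measure (leb n) mphi))); last first.
  by move=> A mA _; exact: (leb_affine t c0 mA).
rewrite ge0_integral_mscale//; congr (_ * _)%E.
by apply: (ge0_integral_pushforward mphi) => // y _; exact: f0.
Qed.

Lemma energy_affine (f : 'rV[R]_n -> R[i]) : cmeas f ->
  energy (leb n) f = ((`|c| ^+ n)%:E * energy (leb n) (f \o phi))%E.
Proof.
move=> mf; rewrite /energy ge0_integral_affine//.
- exact/measurable_EFinP/measurable_sqn.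
- by move=> x; rewrite lee_fin sqn_ge0.
Qed.

Lemma square_integrable_affine (f : 'rV[R]_n -> R[i]) :
  square_integrable (leb n) f -> square_integrable (leb n) (f \o phi).
Proof.
move=> [mf If]; split; first exact: (cmeas_comp mf mphi).
move: If; rewrite (energy_affine mf); case: (energy _ _) (energy_ge0 (leb n) (f \o phi)).
- by move=> r _ _; rewrite ltry.
(* An infinite energy would remain infinite after multiplication by |c|^n > 0. *)
- by move=> _; rewrite gt0_muley// lte_fin exprn_gt0// normr_gt0.
- by [].
Qed.

Lemma cintegrable_affine (f : 'rV[R]_n -> R[i]) :
  cintegrable (leb n) f -> cintegrable (leb n) (f \o phi).
Proof.
move=> /cintegrableP[mf If]; apply/cintegrableP.
split; first exact: (cmeas_comp mf mphi).
move: If; rewrite ge0_integral_affine; last 2 first.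
- exact/measurable_EFinP/measurable_normc.
- by move=> x; rewrite lee_fin normc_ge0.
have : (0 <= \int[leb n]_x (Normc.normc (f (c *: x + t)%R))%:E)%E.
  by apply: integral_ge0 => x _; rewrite lee_fin normc_ge0.
case: (integral _ _ _).
- by move=> r _ _; rewrite ltry.
- by move=> _; rewrite gt0_muley// lte_fin exprn_gt0// normr_gt0.
- by [].
Qed.

Lemma Rintegral_affine (f : 'rV[R]_n -> R) :
  (leb n).-integrable setT (EFin \o f) ->
  (leb n).-integrable setT (fun x => (f (c *: x + t))%:E) ->
  \int[leb n]_x f x = `|c| ^+ n * \int[leb n]_x f (c *: x + t).
Proof.
move=> If Ifc; rewrite /Rintegral.
have mf := measurable_int _ If.
rewrite integralE ge0_integral_affine//; last exact: measurable_funepos.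
rewrite [X in fine (_ - X)]ge0_integral_affine//; last exact: measurable_funeneg.
(* Integrability after the change of variables rules out the form oo - oo. *)
rewrite -muleBr//; last first.
  by have := integrable_add_def measurableT Ifc; rewrite !unlock.
rewrite -[RHS]/(fine (`|c| ^+ n)%:E * _) -fineM//; last exact: integrable_fin_num.
by rewrite [in RHS]integralE !unlock.
Qed.

Lemma cint_affine (f : 'rV[R]_n -> R[i]) : cintegrable (leb n) f ->
  cint (leb n) f = (`|c| ^+ n)%:C * cint (leb n) (f \o phi).
Proof.
move=> If; have [f1 f2] := If; have [g1 g2] := cintegrable_affine If.
by apply: complexP; rewrite ?ReM ?ImM /= !mul0r ?subr0 ?addr0; exact: Rintegral_affine.
Qed.

End affine_change_of_variables.

(** * Fubini for products of functions of one coordinate *)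

Section product_functions.
Context {R : realType}.

(** [leb n.+1] is defined with [\x^], whereas Fubini is applied to [\x]. Both agree on rectangles,
    and uniqueness of the product measure identifies them. *)
Lemma lebS n (A : set 'rV[R]_n.+1) : measurable A ->
  image_measure (prod_measure (@lebesgue_measure R) (leb n)) (measurable_consrV (n:=n)) A
  = leb n.+1 A.
Proof.
move=> mA; rewrite /leb /= /cons_measure /pushforward /prod_measure.
apply: product_measure_unique => [B C mB mC|]; first exact: product_measure2E.
by rewrite -[X in measurable X]setTI; exact: measurable_consrV.
Qed.

(** Fubini by induction on the dimension, splitting off the first coordinate with [consrV]. In
    dimension 0 the measure is a unit point mass and the product is empty. *)
Lemma cint_prod n (u : 'I_n -> R -> R[i]) :
  (forall i, cintegrable (@lebesgue_measure R) (u i)) ->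
  cintegrable (leb n) (fun x => \prod_(i < n) u i (x ord0 i)) /\
  cint (leb n) (fun x => \prod_(i < n) u i (x ord0 i)) =
    \prod_(i < n) cint (@lebesgue_measure R) (u i).
Proof.
elim: n u => [|n IH] u Iu.
  rewrite big_ord0.
  have -> : (fun x : 'rV[R]_0 => \prod_(i < 0) u i (x ord0 i)) = (fun=> 1).
    by apply/funext => x; rewrite big_ord0.
  split.
    apply/cintegrableP; split; first exact: cmeas_cst.
    by rewrite integral_dirac// diracT mul1e ltry.
  by apply: complexP => /=; rewrite /Rintegral integral_dirac// diracT mul1e.
have [Iv Ev] := IH (fun i => u (lift ord0 i)) (fun i => Iu (lift ord0 i)).
have [I E] := cintegrable_prod (Iu ord0) Iv.
set f := fun x : 'rV[R]_n.+1 => _.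
have fE : f \o (@consrV R n) = fun p => u ord0 p.1 *
    \prod_(i < n) u (lift ord0 i) (p.2 ord0 i).
  apply/funext => p; rewrite /f/= big_ord_recl consrV0; congr (_ * _).
  by apply: eq_bigr => i _; rewrite consrVS.
have mf : cmeas f.
  apply: cmeas_prod => i.
  exact: (cmeas_comp (cintegrable_cmeas (Iu i)) (measurable_coord i)).
have If : cintegrable (image_measure (prod_measure (@lebesgue_measure R) (leb n))
    (measurable_consrV (n:=n))) f.
  by apply: cintegrable_image => //; rewrite fE.
split.
  by apply: eq_measure_cintegrable If => A mA; exact: lebS.
transitivity (cint (image_measure (prod_measure (@lebesgue_measure R) (leb n))
    (measurable_consrV (n:=n))) f).
  by apply/esym/eq_measure_cint => A mA; exact: lebS.
rewrite cint_image//; last by rewrite fE.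
by rewrite fE E Ev big_ord_recl.
Qed.

End product_functions.

(** * Transforms of intervals and boxes *)

Section interval_transform.
Context {R : realType}.
Implicit Types (a b c d t w x : R).
Local Notation mu := (@lebesgue_measure R).

Lemma sin_sqr_le x : sin x ^+ 2 <= x ^+ 2.
Proof.
wlog x0 : x / 0 <= x.
  move=> H; have [/H//|/ltW x0] := leP 0 x.
  by rewrite -sqrrN -sinN -(sqrrN x) H// oppr_ge0.
have [c _] : exists2 c, c \in `[0, x] & sin x - sin 0 = cos c * (x - 0).
  by apply: MVT_segment => //; apply: continuous_subspaceT; exact: continuous_sin.
by rewrite sin0 !subr0 => ->; rewrite exprMn ler_piMl ?sqr_ge0.
Qed.

(** The Fejer kernel of the real line, up to normalization. At w = 0 the convention on division
    gives 0 instead of the limit t^2 / 2; a single point does not affect the integral. *)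
Definition fejer t w : R := (1 - cos (t * w)) / w ^+ 2.

Lemma fejer_ge0 t w : 0 <= fejer t w.
Proof. by rewrite divr_ge0 ?sqr_ge0// subr_ge0 cos_le1. Qed.

(** For w^2 <= 1 the bound 1 - cos w <= w^2 / 2 suffices. Beyond, 1 - cos w <= 2 and 1 + w^2 <= 2
    w^2, whence the constant 4. *)
Lemma fejer1_le w : fejer 1 w <= 4 * (oneDsqr w)^-1.
Proof.
rewrite /fejer mul1r.
have [->|w0] := eqVneq w 0.
  by rewrite expr0n/= invr0 mulr0 mulr_ge0// invr_ge0 ltW// oneDsqr_gt0.
have w2 : 0 < w ^+ 2 by rewrite exprn_even_gt0.
rewrite ler_pdivrMr// mulrAC ler_pdivlMr ?oneDsqr_gt0// /oneDsqr.
have h : 1 - cos w <= w ^+ 2 / 2.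
  have -> : cos w = 1 - 2 * sin (w / 2) ^+ 2.
    rewrite [in LHS](_ : w = (w / 2) *+ 2) ?cos_mulr2n ?cos2sin2.
      by rewrite mulr2n; ring.
    by rewrite -mulr_natr divfK.
  by have := sin_sqr_le (w / 2); rewrite (_ : (w / 2) ^+ 2 = w ^+ 2 / 4); [lra|field].
have h2 := cos_geN1 w; have h3 := cos_le1 w.
by have [w1|w1] := leP (w ^+ 2) 1; nra.
Qed.

Lemma measurable_cosM t : measurable_fun setT (fun w => cos (t * w)).
Proof.
apply: (measurableT_comp (continuous_measurable_fun (@continuous_cos R))).
exact: measurable_funM.
Qed.

Lemma measurable_sinM t : measurable_fun setT (fun w => sin (t * w)).
Proof.
apply: (measurableT_comp (continuous_measurable_fun (@continuous_sin R))).
exact: measurable_funM.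
Qed.

(** Writing 1/x as x times a real power of x^2 reduces the claim to measurability of powers, and
    agrees with the default value 0 at the origin. *)
Lemma measurable_inv : measurable_fun setT (fun x : R => x^-1).
Proof.
rewrite (_ : (fun _ => _) = fun x => x * (x ^+ 2) `^ (-1)).
  apply: measurable_funM => //.
  exact: (measurableT_comp (measurable_powR (-1)) (exprn_measurable 2)).
apply/funext => x; rewrite powR_inv1 ?sqr_ge0//.
by have [->|x0] := eqVneq x 0; [rewrite mul0r invr0|field].
Qed.

Lemma measurable_oneDsqrV : measurable_fun setT (fun x : R => (oneDsqr x)^-1).
Proof.
apply: (measurableT_comp measurable_inv).
exact: continuous_measurable_fun (@continuous_oneDsqr R).
Qed.

Lemma measurable_fejer t : measurable_fun setT (fejer t).
Proof.
apply: measurable_funM; first by apply: measurable_funB => //; exact: measurable_cosM.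
exact: (measurableT_comp measurable_inv (exprn_measurable 2)).
Qed.

Lemma ge0_integral_scale (c : R) (f : R -> \bar R) : c != 0 ->
  measurable_fun setT f -> (forall x, (0 <= f x)%E) ->
  (\int[mu]_x f x = `|c|%:E * \int[mu]_x f (c * x)%R)%E.
Proof.
move=> c0 mf f0.
have mphi : measurable_fun (@setT (measurableTypeR R))
    ((fun x : R => c * x + 0) : measurableTypeR R -> measurableTypeR R).
  exact: measurable_affine.
rewrite (@eq_measure_integral _ _ _ _ (mscale (NngNum (normr_ge0 c))
    (image_measure mu mphi))); last first.
  by move=> A mA _; exact: lebesgue_measure_affine.
rewrite ge0_integral_mscale//; congr (_ * _)%E.
rewrite (ge0_integral_pushforward mphi)//.
by apply: eq_integral => x _; rewrite /= addr0.
Qed.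

(** The integral over the positive half-line is known; the negative half-line is reflected onto
    it. *)
Lemma integral_oneDsqrV_lty : (\int[mu]_x ((oneDsqr x)^-1)%:E < +oo)%E.
Proof.
have m1 : measurable_fun setT (fun x : R => ((oneDsqr x)^-1)%:E).
  apply/measurable_EFinP; exact: measurable_oneDsqrV.
have p1 (x : R) : (0 <= ((oneDsqr x)^-1)%:E)%E.
  by rewrite lee_fin invr_ge0 ltW// oneDsqr_gt0.
rewrite (_ : setT = `]-oo, 0[ `|` `[0, +oo[); last first.
  by apply/seteqP; split => // x _ /=; rewrite !in_itv/= andbT; case: ltP; [left|right].
rewrite ge0_integral_setU//=; last 2 first.
- exact: measurable_funS m1.
- by apply/disj_setPLR => x /=; rewrite !in_itv/= andbT => /lt_geF ->.
apply: lte_add_pinfty; last by rewrite integral0y_oneDsqr ltry.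
apply: (@le_lt_trans _ _ (\int[mu]_(x in `]-oo, 0%R]) ((oneDsqr (- x))^-1)%:E)%E).
  under [leRHS]eq_integral do rewrite /oneDsqr sqrrN.
  apply: ge0_subset_integral => //; first exact: measurable_funS m1.
  by move=> x /=; rewrite !in_itv/=; exact: ltW.
rewrite -(ge0_integration_by_substitution0 (f := fun x => ((oneDsqr x)^-1)%:E))//.
by rewrite integral0y_oneDsqr ltry.
Qed.

Lemma integral_fejer1_lty : (\int[mu]_w (fejer 1 w)%:E < +oo)%E.
Proof.
apply: (@le_lt_trans _ _ (\int[mu]_w (4%:E * ((oneDsqr w)^-1)%:E))%E).
  apply: ge0_le_integral => //.
  - by move=> w _; rewrite lee_fin fejer_ge0.
  - apply/measurable_EFinP; exact: measurable_fejer.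
  - by apply: measurable_funeM; apply/measurable_EFinP; exact: measurable_oneDsqrV.
  - by move=> w _; rewrite -EFinM lee_fin fejer1_le.
rewrite ge0_integralZl//; last by apply/measurable_EFinP; exact: measurable_oneDsqrV.
by apply: lte_mul_pinfty => //; exact: integral_oneDsqrV_lty.
Qed.

(** Its value is pi; the proof uses only that it is finite and positive. *)
Definition fejer_const : R := \int[mu]_w fejer 1 w.

Lemma fejer_constE : (\int[mu]_w (fejer 1 w)%:E = fejer_const%:E)%E.
Proof.
rewrite /fejer_const /Rintegral fineK// ge0_fin_numE ?integral_fejer1_lty//.
by apply: integral_ge0 => w _; rewrite lee_fin fejer_ge0.
Qed.

(** On [pi/2, pi] the cosine is nonpositive, so the kernel is at least 1 / w^2 and thus at least 1 /
    pi^2 there. *)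
Lemma fejer_const_gt0 : 0 < fejer_const.
Proof.
rewrite -lte_fin -fejer_constE.
apply: (@lt_le_trans _ _ (\int[mu]_(w in `[(pi / 2 : R)%R, pi]) ((pi : R) ^- 2)%:E)%E).
  rewrite integral_cst//= lebesgue_measure_itv/= lte_fin.
  have p0 := pi_gt0 R.
  rewrite ifT; last by lra.
  rewrite -EFinB -EFinM lte_fin mulr_gt0 ?invr_gt0 ?exprn_gt0//; lra.
apply: (@le_trans _ _ (\int[mu]_(w in `[(pi / 2 : R)%R, pi]) (fejer 1 w)%:E)%E).
  apply: ge0_le_integral => //.
  - by move=> w _; rewrite lee_fin invr_ge0 exprn_ge0// pi_ge0.
  - by apply/measurable_EFinP; apply: measurable_funS (measurable_fejer 1).
  move=> w /=; rewrite in_itv/= => /andP[w1 w2]; rewrite lee_fin /fejer mul1r.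
  have p0 := pi_gt0 R.
  have w0 : 0 < w by rewrite (lt_le_trans _ w1)// divr_gt0.
  have cw : cos w <= 0.
    rewrite -(subrK (pi / 2) w) cosDpihalf oppr_le0 sin_ge0_pi//; lra.
  apply: (@le_trans _ _ (w ^- 2)).
    by rewrite lef_pV2 ?posrE ?exprn_gt0// ler_sqr// nnegrE ltW.
  by rewrite ler_peMl ?invr_ge0 ?sqr_ge0//; lra.
apply: ge0_subset_integral => //.
- apply/measurable_EFinP; exact: measurable_fejer.
- by move=> w _; rewrite lee_fin fejer_ge0.
Qed.

Lemma integral_fejer t :
  (\int[mu]_w (fejer t w)%:E = (fejer_const * `|t|)%:E)%E.
Proof.
have [->|t0] := eqVneq t 0.
  rewrite normr0 mulr0 -[RHS](integral0 mu setT).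
  by apply: eq_integral => w _; rewrite /fejer mul0r cos0 subrr mul0r.
have := fejer_constE; rewrite (@ge0_integral_scale t)//; last 2 first.
- apply/measurable_EFinP; exact: measurable_fejer.
- by move=> w; rewrite lee_fin fejer_ge0.
have -> : (fun w => (fejer 1 (t * w))%:E) = (fun w => (t ^- 2)%:E * (fejer t w)%:E)%E.
  apply/funext => w; rewrite -EFinM /fejer mul1r exprMn invfM; congr (_%:E).
  by rewrite mulrCA.
rewrite ge0_integralZl//; last 3 first.
- apply/measurable_EFinP; exact: measurable_fejer.
- by move=> w _; rewrite lee_fin fejer_ge0.
- by rewrite lee_fin invr_ge0 sqr_ge0.
move=> E; rewrite (mulrC fejer_const) EFinM -E !muleA -!EFinM.
rewrite -[t ^- 2]/((t ^+ 2)^-1) -real_normK ?num_real//.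
have t0' : `|t| != 0 by rewrite normr_eq0.
by rewrite (_ : _ * _ = 1) ?mul1e//; field.
Qed.

Lemma integrable_fejer t : mu.-integrable setT (EFin \o fejer t).
Proof.
apply/integrableP; split; first by apply/measurable_EFinP; exact: measurable_fejer.
under eq_integral do rewrite /= ger0_norm ?fejer_ge0//.
by rewrite integral_fejer ltry.
Qed.


(** This is e^(-ix), with the sign that [fourier] uses. *)
Definition cis x : R[i] := cos x -i* sin x.

Lemma cisD x y : cis (x + y) = cis x * cis y.
Proof.
by apply: complexP; rewrite ReImE /cis /= ?cosD ?sinD; ring.
Qed.

Lemma sqn_cis x : sqn (cis x) = 1.
Proof. by rewrite /sqn /= sqrrN cos2Dsin2. Qed.

Lemma cis0 : cis 0 = 1.
Proof. by rewrite /cis cos0 sin0 oppr0. Qed.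

(* The Fourier transform of the indicator function of ]a, b], up to the constant
   that makes the transform an isometry and up to a factor i. *)
Definition itv_transform a b w : R[i] :=
  ((Num.sqrt (2 * fejer_const))^-1 / w)%:C * (cis (a * w) - cis (b * w)).

Lemma itv_transformD a b t w :
  itv_transform (a + t) (b + t) w = cis (t * w) * itv_transform a b w.
Proof.
by rewrite /itv_transform !mulrDl !cisD; ring.
Qed.

Lemma cmeas_cisM a : cmeas (fun w => cis (a * w)).
Proof.
split; first exact: measurable_cosM.
by apply: measurable_funN; exact: measurable_sinM.
Qed.

Lemma cmeas_itv_transform a b : cmeas (itv_transform a b).
Proof.
apply: cmeasM.
  apply: cmeas_real; apply: measurable_funM => //; exact: measurable_inv.
by apply: cmeasD; [|apply: cmeasN]; exact: cmeas_cisM.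
Qed.

(** The product gives four cosines, two with each sign, so a 1 can be inserted into each of them at
    no cost. The result is split into Fejer kernels, which are integrable one by one. *)
Lemma Re_itv_transform a b c d w :
  complex.Re (itv_transform a b w * (itv_transform c d w)^*) =
  (2 * fejer_const)^-1 *
    (fejer (a - d) w + fejer (b - c) w - fejer (a - c) w - fejer (b - d) w).
Proof.
rewrite /itv_transform /fejer !ReImE /= !mulrBl !cosB.
have -> : (2 * fejer_const)^-1 = (Num.sqrt (2 * fejer_const))^-1 ^+ 2.
  by rewrite exprVn sqr_sqrtr// mulr_ge0// ltW// fejer_const_gt0.
rewrite -[w ^- 2]/((w ^+ 2)^-1) -exprVn; ring.
Qed.

(** In a product of one transform with the conjugate of another the two minus signs cancel; thus w
    -> -w conjugates the product. *)
Lemma itv_transformN a b w : itv_transform a b (- w) = - (itv_transform a b w)^*.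
Proof.
apply: complexP; rewrite /itv_transform !ReImE /= invrN !mulrN !cosN !sinN; ring.
Qed.

Lemma square_integrable_itv_transform a b :
  square_integrable mu (itv_transform a b).
Proof.
apply/square_integrableP; split; first exact: cmeas_itv_transform.
have -> : EFin \o (fun w => sqn (itv_transform a b w)) = EFin \o (fun w =>
  (2 * fejer_const)^-1 *
    (fejer (a - b) w + fejer (b - a) w - fejer (a - a) w - fejer (b - b) w)).
  by apply/funext => w /=; rewrite -Re_itv_transform Re_mulJ.
apply: integrableZl_EFin.
have I t := integrable_fejer t.
exact: (integrableB measurableT (integrableB measurableT
  (integrableD measurableT (I _) (I _)) (I _)) (I _)).
Qed.

Lemma cintegrable_itv_transform a b c d :
  cintegrable mu (fun w => itv_transform a b w * (itv_transform c d w)^*).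
Proof.
apply: square_integrable_mul; first exact: square_integrable_itv_transform.
exact/square_integrableJ/square_integrable_itv_transform.
Qed.

(** The overlap is put in the form produced by the four Fejer kernels of [Re_itv_transform]; the
    cases are the relative positions of the endpoints. *)
Lemma lebesgue_measure_itvI a b c d : a <= b -> c <= d ->
  (@lebesgue_measure R (`]a, b] `&` `]c, d]) =
   ((`|a - d| + `|b - c| - `|a - c| - `|b - d|) / 2)%:E)%E.
Proof.
move=> ab cd.
rewrite (_ : _ `&` _ = `](Num.max a c), (Num.min b d)]%classic); last first.
  apply/seteqP; split=> x /=; rewrite !in_itv/= gt_max le_min.
    by move=> [/andP[-> ->] /andP[-> ->]].
  by move=> /andP[/andP[? ?] /andP[? ?]]; split; apply/andP.
rewrite lebesgue_measure_itv/= lte_fin -EFinB.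
rewrite -[X in if _ then _ else X]/((0 : R)%:E) -fun_if; congr (_%:E).
have [ac|ca] := leP a c; have [bd|db] := leP b d.
- rewrite (ler0_norm (_ : a - d <= 0)) ?(ler0_norm (_ : a - c <= 0))
    ?(ler0_norm (_ : b - d <= 0)) ?subr_le0// ?(le_trans ac)//.
  by have [|] := ltP c b => cb;
    [rewrite ger0_norm ?subr_ge0 ?ltW//|rewrite ler0_norm ?subr_le0//]; lra.
- rewrite (ler0_norm (_ : a - d <= 0)) ?(ler0_norm (_ : a - c <= 0))
    ?(gtr0_norm (_ : 0 < b - d)) ?subr_gt0 ?subr_le0// ?(le_trans ac)//.
  rewrite ger0_norm ?subr_ge0 ?(le_trans cd)// ?ltW//.
  by have [|] := ltP c d => ?; lra.
- rewrite (gtr0_norm (_ : 0 < a - c)) ?(ler0_norm (_ : b - d <= 0))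
    ?(ger0_norm (_ : 0 <= b - c)) ?subr_gt0 ?subr_ge0 ?subr_le0// ?(le_trans (ltW ca))//.
  rewrite ler0_norm ?subr_le0 ?(le_trans ab)//.
  by have [|] := ltP a b => ?; lra.
- rewrite (gtr0_norm (_ : 0 < a - c)) ?(gtr0_norm (_ : 0 < b - d))
    ?(ger0_norm (_ : 0 <= b - c)) ?subr_gt0 ?subr_ge0// ?(le_trans (ltW ca))//.
  by have [|] := ltP a d => ad;
    [rewrite ltr0_norm ?subr_lt0//|rewrite ger0_norm ?subr_ge0//]; lra.
Qed.

(** In the real part, the 2 [fejer_const] of the normalization turns the four integrals of
    [integral_fejer] into the overlap. The imaginary part vanishes because reflection shows the
    integral to be its own conjugate. *)
Lemma cint_itv_transform a b c d : a <= b -> c <= d ->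
  cint mu (fun w => itv_transform a b w * (itv_transform c d w)^*) =
  (fine (@lebesgue_measure R (`]a, b] `&` `]c, d])))%:C.
Proof.
move=> ab cd; rewrite lebesgue_measure_itvI//=.
have I := cintegrable_itv_transform a b c d.
have fn t := integrable_fejer t.
apply: complexP.
  rewrite Re_cintE; under eq_Rintegral do rewrite Re_itv_transform.
  rewrite RintegralZl//; last first.
    exact: (integrableB measurableT (integrableB measurableT
      (integrableD measurableT (fn _) (fn _)) (fn _)) (fn _)).
  rewrite RintegralB//; last first.
    exact: (integrableB measurableT (integrableD measurableT (fn _) (fn _)) (fn _)).
  rewrite RintegralB//; last first.
    exact: (integrableD measurableT (fn _) (fn _)).
  rewrite RintegralD// /Rintegral !integral_fejer /=.
  by have := fejer_const_gt0; move=> k0; field; rewrite gt_eqF.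
have mphi : measurable_fun (@setT (measurableTypeR R))
    ((fun x : R => (-1) * x + 0) : measurableTypeR R -> measurableTypeR R).
  exact: measurable_affine.
have E : (fun w => itv_transform a b w * (itv_transform c d w)^*) \o
    (fun x : R => (-1) * x + 0) =
    (fun w => (itv_transform a b w * (itv_transform c d w)^*)^*).
  have H (z w : R[i]) : - z^* * (- w^*)^* = (z * w^*)^*.
    by apply: complexP; rewrite !ReImE; ring.
  by apply/funext => w; rewrite /= addr0 mulN1r !itv_transformN H.
have e : cint mu (fun w => itv_transform a b w * (itv_transform c d w)^*) =
    (cint mu (fun w => itv_transform a b w * (itv_transform c d w)^*))^*.
  rewrite -cintJ// -E -(cint_image mphi).
  - apply: eq_measure_cint => A mA.
    by rewrite [LHS](@lebesgue_measure_affine _ (-1) 0)// normrN1 mul1e.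
  - exact: cintegrable_cmeas I.
  - by rewrite E; exact: cintegrableJ.
exact: Im_eqJ.
Qed.

End interval_transform.

Section inner_product.
Context d (T : measurableType d) (R : realType).
Variable mu : {measure set T -> \bar R}.
Implicit Types (f g h : T -> R[i]).

Definition inner f g : R[i] := cint mu (fun x => f x * (g x)^*).

(** Linearity in the shape of a [step_cons], as met in the induction of [step_gram]. *)
Lemma innerDZl c f g h :
  square_integrable mu f -> square_integrable mu g -> square_integrable mu h ->
  inner (fun x => c * f x + g x) h = c * inner f h + inner g h.
Proof.
move=> If Ig Ih.
have I u : square_integrable mu u -> cintegrable mu (fun x => u x * (h x)^*).
  by move=> Iu; apply: square_integrable_mul => //; exact: square_integrableJ.
rewrite /inner -cintZl; last exact: I.
rewrite -cintD; [|exact/cintegrableZl/I|exact: I].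
by congr cint; apply/funext => x; rewrite mulrDl mulrA.
Qed.

Lemma innerDZr c f g h :
  square_integrable mu f -> square_integrable mu g -> square_integrable mu h ->
  inner h (fun x => c * f x + g x) = c^* * inner h f + inner h g.
Proof.
move=> If Ig Ih.
have I u : square_integrable mu u -> cintegrable mu (fun x => h x * (u x)^*).
  by move=> Iu; apply: square_integrable_mul => //; exact: square_integrableJ.
rewrite /inner -cintZl; last exact: I.
rewrite -cintD; [|exact/cintegrableZl/I|exact: I].
by congr cint; apply/funext => x; rewrite rmorphD rmorphM mulrDr mulrCA.
Qed.

Lemma inner0l g : inner (fun=> 0) g = 0.
Proof.
rewrite /inner (_ : (fun x => _) = fun=> 0) ?cint0//.
by apply/funext => x; rewrite mul0r.
Qed.

Lemma inner0r g : inner g (fun=> 0) = 0.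
Proof.
rewrite /inner (_ : (fun x => _) = fun=> 0) ?cint0//.
by apply/funext => x; rewrite rmorph0 mulr0.
Qed.

Lemma inner_energy f : square_integrable mu f ->
  (complex.Re (inner f f))%:E = energy mu f.
Proof.
move=> If; rewrite /inner -Re_cint.
  by rewrite /energy; apply: eq_integral => x _; rewrite Re_mulJ.
by apply: square_integrable_mul => //; exact: square_integrableJ.
Qed.

End inner_product.

Section measurable_dotp.
Context d (T : measurableType d) {R : realType} (n : nat).

Lemma measurable_dotp (u v : T -> 'rV[R]_n) :
  measurable_fun setT u -> measurable_fun setT v ->
  measurable_fun setT (fun x => dotp (u x) (v x)).
Proof.
move=> /measurable_fun_coordP mu /measurable_fun_coordP mv.
rewrite /dotp; elim: (index_enum _) => [|i s IH].
  by under eq_fun do rewrite big_nil; exact: measurable_cst.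
under eq_fun do rewrite big_cons.
by apply: measurable_funD => //; exact: measurable_funM.
Qed.

Lemma cmeas_cis (u : T -> R) : measurable_fun setT u -> cmeas (fun x => cis (u x)).
Proof.
move=> mu; split.
- exact: (measurableT_comp (continuous_measurable_fun (@continuous_cos R)) mu).
- apply: measurable_funN.
  exact: (measurableT_comp (continuous_measurable_fun (@continuous_sin R)) mu).
Qed.

Lemma measurable_rVD (u v : T -> 'rV[R]_n) :
  measurable_fun setT u -> measurable_fun setT v ->
  measurable_fun setT (fun x => u x + v x).
Proof.
move=> /measurable_fun_coordP mu /measurable_fun_coordP mv.
apply/measurable_fun_coordP => i; under eq_fun do rewrite mxE.
exact: measurable_funD.
Qed.

Lemma measurable_rVZ (a : T -> R) (u : T -> 'rV[R]_n) :
  measurable_fun setT a -> measurable_fun setT u ->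
  measurable_fun setT (fun x => a x *: u x).
Proof.
move=> ma /measurable_fun_coordP mu.
apply/measurable_fun_coordP => i; under eq_fun do rewrite mxE.
exact: measurable_funM.
Qed.

Lemma measurable_rVB (u v : T -> 'rV[R]_n) :
  measurable_fun setT u -> measurable_fun setT v ->
  measurable_fun setT (fun x => u x - v x).
Proof.
move=> mu mv; under eq_fun do rewrite -(scaleN1r (v _)).
by apply: measurable_rVD => //; apply: measurable_rVZ.
Qed.

End measurable_dotp.

(** * Step functions and their transforms *)

Section step_functions.
Context {R : realType} {n : nat}.
Local Notation V := 'rV[R]_n.
Implicit Types (a b c d t w x y : V) (f g K : V -> R[i]).

Definition box_indic a b x : R[i] := (\1_(box a b) x)%:C.

Definition box_transform a b w : R[i] :=
  \prod_(i < n) itv_transform (a ord0 i) (b ord0 i) (w ord0 i).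

Lemma dotp_cis y w : cis (dotp y w) = \prod_(i < n) cis (y ord0 i * w ord0 i).
Proof.
rewrite /dotp; elim/big_rec2: _ => [|i p z _ <-]; first exact: cis0.
by rewrite cisD.
Qed.

Lemma box_transformD a b y w :
  box_transform (a + y) (b + y) w = cis (dotp y w) * box_transform a b w.
Proof.
rewrite dotp_cis -big_split/=; apply: eq_bigr => i _.
by rewrite !mxE itv_transformD.
Qed.

Lemma box_translate a b x y : box a b (x - y) = box (a + y) (b + y) x.
Proof.
apply/propext; split=> xab i; have := xab i; rewrite !in_itv/= !mxE;
  by rewrite ltrBrDr lerBlDr.
Qed.

Lemma box_indic_translate a b x y :
  box_indic a b (x - y) = box_indic (a + y) (b + y) x.
Proof.
rewrite /box_indic !indicE.
have -> // : (x - y \in box a b) = (x \in box (a + y) (b + y)).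
by apply/idP/idP; rewrite !inE box_translate.
Qed.

(** Both sides factor over the coordinates, by [cint_prod] and by [leb_rectangle]; each factor is
    the statement for two intervals. *)
Lemma cint_box_transform a b c d :
  (forall i, a ord0 i <= b ord0 i) -> (forall i, c ord0 i <= d ord0 i) ->
  cintegrable (leb n) (fun w => box_transform a b w * (box_transform c d w)^*) /\
  inner (leb n) (box_transform a b) (box_transform c d) =
    (fine (leb n (box a b `&` box c d)))%:C.
Proof.
move=> ab cd.
have [I E] := cint_prod (fun i =>
  cintegrable_itv_transform (a ord0 i) (b ord0 i) (c ord0 i) (d ord0 i)).
have H : (fun w : V => \prod_(i < n)
    (itv_transform (a ord0 i) (b ord0 i) (w ord0 i) *
     (itv_transform (c ord0 i) (d ord0 i) (w ord0 i))^*)) =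
    (fun w => box_transform a b w * (box_transform c d w)^*).
  by apply/funext => w; rewrite big_split/= rmorph_prod.
rewrite H in I E; split => //; rewrite /inner E.
under eq_bigr do rewrite cint_itv_transform//.
rewrite -rmorph_prod/=; congr (_%:C).
have -> : leb n (box a b `&` box c d) = (\prod_(i < n) lebesgue_measure
    (`]a ord0 i, b ord0 i]%classic `&` `]c ord0 i, d ord0 i]%classic))%E.
  rewrite -leb_rectangle => [|i]; last by apply: measurableI; exact: measurable_itv.
  congr leb; apply/seteqP; split=> x /=; first by move=> [xab xcd] i; split.
  by move=> H'; split=> i; have [] := H' i.
(* Once the lengths are exhibited as real numbers, [fine] passes through the product. *)
under [in RHS]eq_bigr do rewrite lebesgue_measure_itvI//.
rewrite prodEFin/=; apply: eq_bigr => i _.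
by rewrite lebesgue_measure_itvI.
Qed.

Lemma square_integrable_box_transform a b : (forall i, a ord0 i <= b ord0 i) ->
  square_integrable (leb n) (box_transform a b).
Proof.
move=> ab; have [I _] := cint_box_transform ab ab; split.
  apply: cmeas_prod => i.
  exact: (cmeas_comp (cmeas_itv_transform _ _) (measurable_coord i)).
rewrite /energy (_ : (fun w => _) = (fun w => (complex.Re
  (box_transform a b w * (box_transform a b w)^*))%:E)).
  by rewrite Re_cint// ltry.
by apply/funext => w; rewrite Re_mulJ.
Qed.

Lemma square_integrable_box_indic a b : square_integrable (leb n) (box_indic a b).
Proof.
split; first by apply: cmeas_real; apply: measurable_indic; exact: measurable_box.
rewrite /energy (_ : (fun w => _) = (fun w => (\1_(box a b) w)%:E)).
  by rewrite integral_indic ?setIT//; [exact: leb_box_lty|exact: measurable_box].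
apply/funext => x; rewrite /box_indic sqn_real indicE.
by case: (_ \in _); rewrite ?expr1n ?expr0n.
Qed.

Lemma inner_box_indic a b c d :
  inner (leb n) (box_indic a b) (box_indic c d) =
    (fine (leb n (box a b `&` box c d)))%:C.
Proof.
rewrite /inner (_ : (fun x => _) = (fun x => (\1_(box a b `&` box c d) x)%:C)).
  apply: complexP => /=; rewrite /Rintegral; last by rewrite integral0.
  rewrite integral_indic ?setIT//.
  by apply: measurableI; exact: measurable_box.
by apply/funext => x; rewrite /box_indic indicI; apply: complexP;
  rewrite !ReImE /=; ring.
Qed.

(* [step f K]: f is a combination of indicators of boxes, and K is the same
   combination of their transforms. *)
Inductive step : (V -> R[i]) -> (V -> R[i]) -> Prop :=
| step_nil : step (fun=> 0) (fun=> 0)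
| step_cons (c : R[i]) a b f K : (forall i, a ord0 i <= b ord0 i) -> step f K ->
    step (fun x => c * box_indic a b x + f x)
         (fun w => c * box_transform a b w + K w).

Definition translate f y := fun x => f (x - y).
Definition modulate K y := fun w => cis (dotp y w) * K w.

Lemma square_integrable_translate f y :
  square_integrable (leb n) f -> square_integrable (leb n) (translate f y).
Proof.
move=> If; have := @square_integrable_affine R n 1 (- y) (oner_neq0 _) f If.
by under eq_fun do rewrite /= scale1r.
Qed.

Lemma energy_translate f y : cmeas f -> energy (leb n) (translate f y) = energy (leb n) f.
Proof.
move=> mf; rewrite [RHS](@energy_affine R n 1 (- y) (oner_neq0 _) f mf).
rewrite normr1 expr1n mul1e; congr energy.
by apply/funext => x; rewrite /= scale1r.
Qed.

Lemma energy_modulate K y : energy (leb n) (modulate K y) = energy (leb n) K.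
Proof.
by rewrite /energy; apply: eq_integral => w _; rewrite sqnM sqn_cis mul1r.
Qed.

Lemma cmeas_modulate K y : cmeas K -> cmeas (modulate K y).
Proof.
move=> mK; apply: cmeasM => //; apply: cmeas_cis; exact: measurable_dotp.
Qed.

Lemma square_integrable_modulate K y :
  square_integrable (leb n) K -> square_integrable (leb n) (modulate K y).
Proof.
by move=> [mK IK]; split; [exact: cmeas_modulate|rewrite energy_modulate].
Qed.

Lemma step_square_integrable f K : step f K ->
  square_integrable (leb n) f /\ square_integrable (leb n) K.
Proof.
elim=> [|c a b {}f {}K ab _ [If IK]].
  by split; exact: square_integrable0.
split; apply: square_integrableD => //; apply: square_integrableZl.
- exact: square_integrable_box_indic.
- exact: square_integrable_box_transform.
Qed.

(** Sesquilinearity reduces the claim to two boxes. Translating a box and modulating its transform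
    yields again a box with its own transform, so that case is [cint_box_transform] for the shifted
    boxes. *)
Lemma step_gram f K f' K' y y' : step f K -> step f' K' ->
  inner (leb n) (translate f y) (translate f' y') =
  inner (leb n) (modulate K y) (modulate K' y').
Proof.
move=> sf sf'.
have trD (c : R[i]) a b g z : translate (fun x => c * box_indic a b x + g x) z =
    (fun x => c * box_indic (a + z) (b + z) x + translate g z x).
  by apply/funext => x; rewrite /translate box_indic_translate.
have moD (c : R[i]) a b g z : modulate (fun x => c * box_transform a b x + g x) z =
    (fun x => c * box_transform (a + z) (b + z) x + modulate g z x).
  by apply/funext => x; rewrite /modulate box_transformD; ring.
have tr0 z : translate (fun=> 0) z = fun=> 0 by [].
have mo0 z : modulate (fun=> 0) z = fun=> 0.
  by apply/funext => w; rewrite /modulate mulr0.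
have le_add (a b z : V) : (forall i, a ord0 i <= b ord0 i) ->
    forall i, (a + z) ord0 i <= (b + z) ord0 i.
  by move=> ab i; rewrite !mxE lerD2r.
have SI := square_integrable_box_indic.
have ST (a b z : V) ab := square_integrable_box_transform (le_add a b z ab).
have [If' IK'] := step_square_integrable sf'.
elim: sf => [|c a b {}f {}K ab sf IH].
  by rewrite tr0 mo0 !inner0l.
have [If IK] := step_square_integrable sf.
rewrite trD moD (innerDZl c (SI (a + y) (b + y))
  (square_integrable_translate y If) (square_integrable_translate y' If')).
rewrite (innerDZl c (ST a b y ab)
  (square_integrable_modulate y IK) (square_integrable_modulate y' IK')).
rewrite {}IH; congr (_ * _ + _).
elim: sf' {If' IK'} => [|c' a' b' {}f' {}K' ab' sf' IH].
  by rewrite tr0 mo0 !inner0r.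
have [If' IK'] := step_square_integrable sf'.
rewrite trD moD (innerDZr c' (SI (a' + y') (b' + y'))
  (square_integrable_translate y' If') (SI (a + y) (b + y))).
rewrite (innerDZr c' (ST a' b' y' ab')
  (square_integrable_modulate y' IK') (ST a b y ab)).
rewrite {}IH; congr (_ * _ + _).
by rewrite inner_box_indic (cint_box_transform _ _).2//; exact: le_add.
Qed.

(** Plancherel for step functions: the equality of Gram kernels at zero shift. *)
Lemma energy_step f K : step f K -> energy (leb n) f = energy (leb n) K.
Proof.
move=> sf; have [If IK] := step_square_integrable sf.
rewrite -!inner_energy//; congr (complex.Re _)%:E.
have tr0 g : translate g 0 = g by apply/funext => x; rewrite /translate subr0.
have mo0 g : modulate g 0 = g.
  apply/funext => w; rewrite /modulate /dotp big1 ?cis0 ?mul1r// => i _.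
  by rewrite mxE mul0r.
by have := step_gram 0 0 sf sf; rewrite !tr0 !mo0.
Qed.

End step_functions.

(** * Density of step functions in L^2 *)

Section density.
Context {R : realType} {n : nat}.
Local Notation V := 'rV[R]_n.
Local Notation energy := (energy (leb n)).
Local Notation square_integrable := (square_integrable (leb n)).
Implicit Types (a b : V) (f g s K : V -> R[i]) (A B : set V).

Lemma step_add f K g L : step f K -> step g L ->
  step (fun x => f x + g x) (fun w => K w + L w).
Proof.
move=> sf sg; elim: sf => [|c a b {}f {}K ab _ IH].
  by under eq_fun do rewrite add0r; under [X in step _ X]eq_fun do rewrite add0r.
under eq_fun do rewrite -addrA; under [X in step _ X]eq_fun do rewrite -addrA.
exact: step_cons.
Qed.

Lemma step_scale (k : R[i]) f K : step f K ->
  step (fun x => k * f x) (fun w => k * K w).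
Proof.
elim=> [|c a b {}f {}K ab _ IH].
  by under eq_fun do rewrite mulr0; exact: step_nil.
under eq_fun do rewrite mulrDr mulrA.
under [X in step _ X]eq_fun do rewrite mulrDr mulrA.
exact: step_cons.
Qed.

Definition approximable f :=
  square_integrable f /\ forall e : R, 0 < e -> exists s K,
    step s K /\ (energy (fun x => f x - s x)%R <= e%:E)%E.

Lemma approximable_step f K : step f K -> approximable f.
Proof.
move=> sf; split; first exact: (step_square_integrable sf).1.
move=> e e0; exists f, K; split => //.
rewrite /energy; under eq_integral do rewrite subrr sqn0.
by rewrite integral0 lee_fin ltW.
Qed.

Lemma approximableD f g : approximable f -> approximable g ->
  approximable (fun x => f x + g x).
Proof.
move=> [If af] [Ig ag]; split; first exact: square_integrableD.
(* [energyD_le] doubles each of the two errors. *)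
move=> e e0; have e4 : 0 < e / 4 by rewrite divr_gt0.
have [s [K [sK fs]]] := af _ e4; have [t [L [tL gt]]] := ag _ e4.
exists (fun x => s x + t x), (fun w => K w + L w).
split; first exact: step_add.
have [[ms _] _] := step_square_integrable sK.
have [[mt _] _] := step_square_integrable tL.
under eq_fun do rewrite opprD addrACA.
apply: le_trans (energyD_le _ _ _) _.
- by apply: cmeasD; [exact: If.1|exact: cmeasN].
- by apply: cmeasD; [exact: Ig.1|exact: cmeasN].
rewrite (_ : e%:E = 2%:E * (e / 4)%:E + 2%:E * (e / 4)%:E)%E.
  by rewrite leeD// lee_wpmul2l.
by rewrite -!EFinM -EFinD; congr (_%:E); field.
Qed.

Lemma approximableZl (c : R[i]) f : approximable f ->
  approximable (fun x => c * f x).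
Proof.
move=> [If af]; split; first exact: square_integrableZl.
(* The added 1 keeps the divisor positive when c = 0. *)
move=> e e0; have c1 : 0 < sqn c + 1 by rewrite ltr_wpDl// sqn_ge0.
have [s [K [sK fs]]] := af (e / (sqn c + 1)) (divr_gt0 e0 c1).
exists (fun x => c * s x), (fun w => c * K w); split; first exact: step_scale.
have [[ms _] _] := step_square_integrable sK.
under eq_fun do rewrite -mulrBr.
rewrite energyZl; last by apply: cmeasD; [exact: If.1|exact: cmeasN].
apply: (@le_trans _ _ ((sqn c)%:E * (e / (sqn c + 1))%:E)%E).
  by rewrite lee_wpmul2l// lee_fin sqn_ge0.
rewrite -EFinM lee_fin mulrA ler_pdivrMr// mulrC ler_wpM2l ?(ltW e0)//.
by rewrite lerDl.
Qed.

Lemma approximable0 : approximable (fun=> 0).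
Proof. exact: approximable_step step_nil. Qed.

Lemma approximable_sum I (r : seq I) (F : I -> V -> R[i]) :
  (forall i, approximable (F i)) -> approximable (fun x => \sum_(i <- r) F i x).
Proof.
move=> aF; elim: r => [|i r IH].
  by under eq_fun do rewrite big_nil; exact: approximable0.
by under eq_fun do rewrite big_cons; exact: approximableD.
Qed.

Lemma cvg0_le (u : (\bar R)^nat) (e : R) : u @ \oo --> 0%E -> 0 < e ->
  exists k, (u k <= e%:E)%E.
Proof.
move=> u0 e0.
have /u0 : nbhs (0%E : \bar R) [set y | (y < e%:E)%E].
  by apply: open_nbhs_nbhs; split;
    [exact: open_ereal_lt_ereal|rewrite /= lte_fin].
by move=> [k _ /(_ k (leqnn k)) /= /ltW uk]; exists k.
Qed.

(** Dominated convergence, applied to the squared errors, brings some [f_ k] close to f in L^2; a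
    step function close to this [f_ k] is then close to f. *)
Lemma approximable_lim (f_ : nat -> V -> R[i]) f (G : V -> \bar R) :
  square_integrable f -> (forall k, approximable (f_ k)) ->
  (leb n).-integrable setT G ->
  (forall k x, ((sqn (f x - f_ k x))%:E <= G x)%E) ->
  (forall x, (sqn (f x - f_ k x))%:E @[k --> \oo] --> (0 : R)%:E) ->
  approximable f.
Proof.
move=> If af IG fG f0; split => // e e0.
have mf k : cmeas (fun x => f x - f_ k x).
  by apply: cmeasD; [exact: If.1|apply: cmeasN; exact: (af k).1.1].
have m_ k : measurable_fun setT (fun x => (sqn (f x - f_ k x))%:E).
  by apply/measurable_EFinP; exact: measurable_sqn.
have c_ : {ae leb n, forall x, setT x ->
    (fun k => (sqn (f x - f_ k x))%:E) @ \oo --> (0 : R)%:E}.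
  by apply: aeW => x _; exact: f0.
have b_ : {ae leb n, forall x k, setT x -> (`|(sqn (f x - f_ k x))%:E| <= G x)%E}.
  by apply: aeW => x k _; rewrite gee0_abs ?lee_fin ?sqn_ge0.
have [_ _] := dominated_convergence measurableT m_ (measurable_cst _) c_ IG b_.
rewrite integral0 => cv.
have e4 : 0 < e / 4 by rewrite divr_gt0.
have [k fk] := cvg0_le cv e4.
have [s [K [sK fs]]] := (af k).2 _ e4.
exists s, K; split => //.
have [[ms _] _] := step_square_integrable sK.
have -> : (fun x => f x - s x) = (fun x => (f x - f_ k x) + (f_ k x - s x)).
  by apply/funext => x; rewrite subrKA.
apply: le_trans (energyD_le _ (mf k) _) _.
  by apply: cmeasD; [exact: (af k).1.1|exact: cmeasN].
rewrite (_ : e%:E = 2%:E * (e / 4)%:E + 2%:E * (e / 4)%:E)%E.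
  by rewrite leeD// lee_wpmul2l.
by rewrite -!EFinM -EFinD; congr (_%:E); field.
Qed.

(** [step_cons] requires ordered corners; if some coordinate is in the wrong order, the box is
    empty. *)
Lemma approximable_box a b : approximable (box_indic a b).
Proof.
have [ab|/existsNP[i /negP]] := pselect (forall i, a ord0 i <= b ord0 i).
  have := approximable_step (step_cons 1 ab step_nil).
  by under eq_fun do rewrite mul1r addr0.
rewrite -ltNge => ba; rewrite (_ : box_indic a b = fun=> 0).
  exact: approximable0.
apply/funext => x; rewrite /box_indic indicE memNset// => /(_ i).
by rewrite in_itv/= => /andP[/lt_le_trans h /h]; rewrite ltNge (ltW ba).
Qed.

Definition indic A x : R[i] := (\1_A x)%:C.

Lemma sqn_indic A x : sqn (indic A x) = \1_A x.
Proof.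
by rewrite /indic sqn_real indicE; case: (_ \in _); rewrite ?expr1n ?expr0n.
Qed.

Lemma energy_indic A : measurable A -> energy (indic A) = leb n A.
Proof.
move=> mA; rewrite /energy; under eq_integral do rewrite sqn_indic.
by rewrite integral_indic// setIT.
Qed.

Lemma square_integrable_indic A k : measurable A ->
  square_integrable (indic (A `&` cube k)).
Proof.
move=> mA; have mAk : measurable (A `&` cube k).
  by apply: measurableI => //; exact: measurable_box.
split; first by apply: cmeas_real; exact: measurable_indic.
rewrite energy_indic//; apply: le_lt_trans (leb_box_lty (const_mx (- k%:R)) (const_mx k%:R)).
by apply: le_measure; rewrite ?inE//; exact: measurable_box.
Qed.

(** Dynkin's argument: the sets whose trace on the fixed cube is approximable form a lambda-system
    containing the boxes. Cutting with the cube keeps every indicator function in L^2 and gives the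
    dominating function for increasing unions. *)
Lemma approximable_indic A k : measurable A -> approximable (indic (A `&` cube k)).
Proof.
move=> mA.
pose H := [set B : set V | measurable B /\ approximable (indic (B `&` cube k))].
suff : <<s @boxes R n >> `<=` H by rewrite -measurable_boxes => /(_ A mA)[].
have mcube : measurable (cube k : set V) by exact: measurable_box.
apply: (lambda_system_subset (@boxes_setI R n)) => //; last first.
  move=> _ [a [b ->]]; split; first exact: measurable_box.
  by rewrite boxI; exact: approximable_box.
split=> //.
- by split=> //; rewrite setTI; exact: approximable_box.
- move=> B C CB [mB aB] [mC aC]; split; first exact: measurableD.
  have := approximableD aB (approximableZl (-1) aC).
  congr approximable; apply/funext => x; rewrite /indic !indicE !(in_setD, in_setI).
  have : x \in C -> x \in B by rewrite !inE; exact: CB.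
  case: (x \in C); case: (x \in B); case: (x \in cube k) => //= CBx;
    by [apply: complexP => /=; ring|have := CBx isT].
- move=> F ndF HF; have mF i : measurable (F i) by have [] := HF i.
  have mUF : measurable (\bigcup_i F i) by exact: bigcupT_measurable.
  split => //.
  apply: (@approximable_lim (fun i => indic (F i `&` cube k)) _
    (fun x => (\1_(cube k) x)%:E)).
  + exact: square_integrable_indic.
  + by move=> i; have [] := HF i.
  + apply/integrableP; split; first by apply/measurable_EFinP; exact: measurable_indic.
    under eq_integral do rewrite /= ger0_norm//.
    by rewrite integral_indic// setIT leb_box_lty.
  + move=> i x; rewrite lee_fin /indic -rmorphB sqn_real !indicE !in_setI.
    case: (x \in cube k); case: (x \in _); case: (x \in _) => /=;
      rewrite ?subrr ?subr0 ?sub0r ?sqrrN ?expr1n ?expr0n//=.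
  + move=> x; apply: cvg_near_cst.
    have [[N _ FNx]|nFx] := pselect ((\bigcup_i F i) x).
      exists N => // i /= Ni; rewrite /indic !indicE !in_setI.
      have Fix : F i x by have /subsetPset := ndF _ _ Ni; exact.
      have -> : (x \in \bigcup_i F i) by rewrite inE; exists i.
      have -> : (x \in F i) by rewrite inE.
      by rewrite subrr sqn0.
    exists 0%N => // i /= _; rewrite /indic !indicE !in_setI.
    have -> : (x \in \bigcup_i F i) = false by exact: memNset.
    have -> : (x \in F i) = false by apply: memNset => Fix; apply: nFx; exists i.
    by rewrite subrr sqn0.
Qed.

Import HBNNSimple.

(** Simple functions increasing to h are cut off to growing cubes, which makes them combinations of
    indicators of bounded sets. The error stays between 0 and h, so h^2 dominates its square. *)
Lemma approximable_real (h : V -> R) : measurable_fun setT h ->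
  (forall x, 0 <= h x) -> square_integrable (fun x => (h x)%:C) ->
  approximable (fun x => (h x)%:C).
Proof.
move=> mh h0 Ih.
have mEh : measurable_fun setT (EFin \o h) by exact/measurable_EFinP.
pose s_ := nnsfun_approx measurableT mEh.
have sle k x : s_ k x <= h x.
  rewrite -lee_fin /s_ nnsfun_approxE; apply: le_approx => // y _ /=.
  by rewrite lee_fin.
have scvg x : s_ k x @[k --> \oo] --> h x.
  have h0' y : setT y -> (0 <= (EFin \o h) y)%E by move=> _; rewrite lee_fin.
  by have /fine_cvg := cvg_nnsfun_approx measurableT mEh h0' (I : setT x).
apply: (@approximable_lim (fun k x => (s_ k x * \1_(cube k) x)%:C) _
  (fun x => (sqn (h x)%:C)%:E)) => //.
- move=> k.
  have [N [c sE]] : exists N (c : 'I_N -> R), forall x,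
      s_ k x = \sum_(i < N) c i * \1_(s_ k @^-1` [set c i]) x.
    by eexists; eexists; exact: fimfunEord.
  have -> : (fun x => (s_ k x * \1_(cube k) x)%:C) = (fun x =>
      \sum_(i < N) (c i)%:C * indic (s_ k @^-1` [set c i] `&` cube k) x).
    apply/funext => x; rewrite sE mulr_suml rmorph_sum.
    apply: eq_bigr => i _; rewrite -mulrA rmorphM/=; congr (_ * _).
    by rewrite /indic indicI.
  apply: approximable_sum => i; apply: approximableZl.
  by apply: approximable_indic; exact: measurable_sfunP.
- exact: ((square_integrableP _ _).1 Ih).2.
- move=> k x; rewrite lee_fin -rmorphB !sqn_real ler_sqr ?nnegrE ?subr_ge0//.
    by rewrite lerBlDr lerDl mulr_ge0// indicE.
  rewrite (le_trans _ (sle k x))// ler_piMr ?indicE//.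
  by case: (_ \in _).
- move=> x; have [k0 _ k0x] : exists2 k, True & cube k x.
    have [k _ kx] : (\bigcup_k cube k) x by rewrite bigcup_cube.
    by exists k.
  have c1 : (h x - s_ k x) ^+ 2 @[k --> \oo] --> (0 : R).
    have c : h x - s_ k x @[k --> \oo] --> (0 : R).
      by rewrite -(subrr (h x)); apply: cvgB; [exact: cvg_cst|exact: scvg].
    by under eq_fun do rewrite expr2; rewrite -(mulr0 0); exact: cvgM.
  have c2 : ((h x - s_ k x) ^+ 2)%:E @[k --> \oo] --> (0 : R)%:E.
    by apply: cvg_EFin => //; exact: nearW.
  (* From [k0] on, x lies in the cube and the cut-off is invisible. *)
  apply: cvg_trans c2; apply: near_eq_cvg; exists k0 => // k /= k0k.
  rewrite -rmorphB sqn_real indicE mem_set ?mulr1//.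
  exact: subset_cube k0x.
Qed.

Lemma approximable_square_integrable f : square_integrable f -> approximable f.
Proof.
move=> If; have [[mRe mIm] _] := If.
have P (h : V -> R) : measurable_fun setT h -> (forall x, h x ^+ 2 <= sqn (f x)) ->
    approximable (fun x => (h x)%:C).
  move=> mh hf.
  have Q (u : V -> R) : measurable_fun setT u -> (forall x, 0 <= u x) ->
      (forall x, u x <= `|h x|) -> approximable (fun x => (u x)%:C).
    move=> mu u0 uh; apply: approximable_real => //.
    split; first exact: cmeas_real.
    apply: le_lt_trans If.2; apply: ge0_le_integral => //.
    + by move=> x _; rewrite lee_fin sqn_ge0.
    + by apply/measurable_EFinP; apply: measurable_sqn; exact: cmeas_real.
    + by apply/measurable_EFinP; apply: measurable_sqn; exact: If.1.
    move=> x _; rewrite lee_fin sqn_real (le_trans _ (hf x))//.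
    by rewrite -[leRHS]real_normK ?num_real// ler_sqr ?nnegrE.
  have ap : approximable (fun x => (Num.max (h x) 0)%:C).
    apply: Q; first exact: measurable_maxr.
      by move=> x; rewrite le_max lexx orbT.
    by move=> x; rewrite ge_max normr_ge0 ler_norm.
  have an : approximable (fun x => (Num.max (- h x) 0)%:C).
    apply: Q; first by apply: measurable_maxr => //; exact: measurable_funN.
      by move=> x; rewrite le_max lexx orbT.
    by move=> x; rewrite ge_max normr_ge0 -normrN ler_norm.
  have := approximableD ap (approximableZl (-1) an).
  congr approximable; apply/funext => x; rewrite mulN1r -rmorphB; congr (_%:C).
  by case: (leP (h x) 0) => h0; case: (leP (- h x) 0) => h1; lra.
have aRe : approximable (fun x => (complex.Re (f x))%:C).
  by apply: P => // x; rewrite lerDl sqr_ge0.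
have aIm : approximable (fun x => (complex.Im (f x))%:C).
  by apply: P => // x; rewrite lerDr sqr_ge0.
have := approximableD aRe (approximableZl 'i%C aIm).
by congr approximable; apply/funext => x; rewrite -complexE.
Qed.

End density.

(** * Convolution *)

Section cint_measurability.
Context d1 d2 (Z : measurableType d1) (Y : measurableType d2) (R : realType).
Variable m : {sigma_finite_measure set Y -> \bar R}.

(** Tonelli for the positive and negative parts. Parameters at which the integral diverges are
    covered by default values, and [fine] is measurable. *)
Lemma measurable_Rintegral_param (u : Z * Y -> R) : measurable_fun setT u ->
  measurable_fun setT (fun z => \int[m]_y u (z, y)).
Proof.
move=> mu; have mEu : measurable_fun setT (EFin \o u) by exact/measurable_EFinP.
apply: (measurableT_comp (fine_measurable measurableT)).
rewrite (_ : (fun z => _) = (fun z => \int[m]_y (EFin \o u)^\+ (z, y) -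
    \int[m]_y (EFin \o u)^\- (z, y))%E).
  apply: emeasurable_funB.
  - apply: (measurable_fun_fubini_tonelli_F (m2 := m) (EFin \o u)^\+%E) => //.
    exact: measurable_funepos.
  - apply: (measurable_fun_fubini_tonelli_F (m2 := m) (EFin \o u)^\-%E) => //.
    exact: measurable_funeneg.
by apply/funext => z; rewrite integralE !unlock.
Qed.

Lemma cmeas_cint (F : Z * Y -> R[i]) : cmeas F ->
  cmeas (fun z => cint m (fun y => F (z, y))).
Proof.
move=> [F1 F2]; split.
- exact: (measurable_Rintegral_param F1).
- exact: (measurable_Rintegral_param F2).
Qed.

Lemma measurable_energy (F : Z * Y -> R[i]) : cmeas F ->
  measurable_fun setT (fun z => energy m (fun y => F (z, y))).
Proof.
move=> mF; apply: (measurable_fun_fubini_tonelli_F (m2 := m) (fun z => (sqn (F z))%:E)).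
- exact/measurable_EFinP/measurable_sqn.
- by move=> x; rewrite lee_fin sqn_ge0.
Qed.

End cint_measurability.

Section convolution.
Context {R : realType} {n : nat}.
Local Notation V := 'rV[R]_n.
Implicit Types (f g h : V -> R[i]) (x y w : V).

Lemma convolE f g x : convol f g x = cint (leb n) (fun y => f (x - y) * g y).
Proof. by []. Qed.

Lemma fourierE g w : fourier g w = cint (leb n) (fun x => g x * cis (dotp x w)).
Proof. by []. Qed.

Lemma cintegrable_fourier f w : cintegrable (leb n) f ->
  cintegrable (leb n) (fun x => f x * cis (dotp x w)).
Proof.
move=> If.
have mc : cmeas (fun y => f y * cis (dotp y w)).
  apply: cmeasM; first exact: cintegrable_cmeas If.
  by apply: cmeas_cis; exact: measurable_dotp.
apply: (cintegrable_le mc (integrable_normc If)) => y.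
rewrite Normc.normcM ler_piMr ?normc_ge0//.
by rewrite -(ler_sqr (_ : _ \in Num.nneg) (_ : 1 \in Num.nneg)) ?nnegrE ?normc_ge0//
  sqr_normc sqn_cis expr1n.
Qed.

(** Joint measurability in the parameter and the point is what Tonelli over the scales requires; f
    depends on the parameter too, as it does from the second layer on. *)
Lemma cmeas_convol_param d (P : measurableType d) (f g : P * V -> R[i]) :
  cmeas f -> cmeas g ->
  cmeas (fun z : P * V => convol (fun x => f (z.1, x)) (fun y => g (z.1, y)) z.2).
Proof.
move=> mf mg.
apply: (cmeas_cint (leb n) (F := fun q : (P * V) * V =>
  f (q.1.1, q.1.2 - q.2) * g (q.1.1, q.2))).
apply: cmeasM.
- apply: (cmeas_comp (phi := fun q : (P * V) * V => (q.1.1, q.1.2 - q.2)) mf).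
  apply: measurable_fun_pair; first exact: measurableT_comp.
  by apply: measurable_rVB; [exact: measurableT_comp|].
- apply: (cmeas_comp (phi := fun q : (P * V) * V => (q.1.1, q.2)) mg).
  by apply: measurable_fun_pair; first exact: measurableT_comp.
Qed.

Lemma cmeas_convol f g : cmeas f -> cmeas g -> cmeas (convol f g).
Proof.
move=> mf mg.
(* V serves as a dummy parameter space, on which neither function depends; the result is restricted
   to the diagonal. *)
have H := @cmeas_convol_param _ V (f \o snd) (g \o snd)
  (cmeas_comp mf measurable_snd) (cmeas_comp mg measurable_snd).
apply: (cmeas_comp (phi := fun x : V => (x, x)) H).
exact: measurable_fun_pair.
Qed.

Lemma cmeas_fourier_param d (P : measurableType d) (g : P * V -> R[i]) :
  cmeas g -> cmeas (fun z : P * V => fourier (fun x => g (z.1, x)) z.2).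
Proof.
move=> mg.
apply: (cmeas_cint (leb n) (F := fun q : (P * V) * V =>
  g (q.1.1, q.2) * cis (dotp q.2 q.1.2))).
apply: cmeasM.
- apply: (cmeas_comp (phi := fun q : (P * V) * V => (q.1.1, q.2)) mg).
  by apply: measurable_fun_pair; first exact: measurableT_comp.
- by apply: cmeas_cis; apply: measurable_dotp; [|exact: measurableT_comp].
Qed.

Lemma square_integrable_reflect f x : square_integrable (leb n) f ->
  square_integrable (leb n) (fun y => f (x - y)).
Proof.
have N1 : -1 != 0 :> R by rewrite oppr_eq0 oner_eq0.
move=> /(square_integrable_affine x N1).
by under eq_fun do rewrite /= scaleN1r addrC.
Qed.

Lemma energy_reflect f x : cmeas f ->
  energy (leb n) (fun y => f (x - y)) = energy (leb n) f.
Proof.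
move=> mf; have N1 : -1 != 0 :> R by rewrite oppr_eq0 oner_eq0.
rewrite [RHS](energy_affine x N1)// normrN1 expr1n mul1e; congr energy.
by apply/funext => y; rewrite /= scaleN1r addrC.
Qed.

Lemma cintegrable_convol f g x : square_integrable (leb n) f ->
  square_integrable (leb n) g -> cintegrable (leb n) (fun y => f (x - y) * g y).
Proof.
by move=> If Ig; apply: square_integrable_mul => //; exact: square_integrable_reflect.
Qed.

Lemma convolDl f h g x : square_integrable (leb n) f ->
  square_integrable (leb n) h -> square_integrable (leb n) g ->
  convol (fun y => f y + h y) g x = convol f g x + convol h g x.
Proof.
move=> If Ih Ig; rewrite !convolE -cintD; [|exact: cintegrable_convol..].
by congr cint; apply/funext => y; rewrite mulrDl.
Qed.

Lemma convolNl f g x : square_integrable (leb n) f ->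
  square_integrable (leb n) g ->
  convol (fun y => - f y) g x = - convol f g x.
Proof.
move=> If Ig; rewrite !convolE -cintN; last exact: cintegrable_convol.
by congr cint; apply/funext => y; rewrite mulNr.
Qed.

Let cmeas_translates f : cmeas f -> cmeas (fun z : V * V => f (z.1 - z.2)).
Proof.
move=> mf; apply: (cmeas_comp (phi := fun z : V * V => z.1 - z.2) mf).
exact: measurable_rVB.
Qed.

Let translates_energy f y : square_integrable (leb n) f ->
  (energy (leb n) (fun x => f (x - y)%R) <= (fine (energy (leb n) f))%:E)%E.
Proof.
move=> If; rewrite (energy_translate y If.1) fineK//.
by rewrite ge0_fin_numE ?energy_ge0//; exact: If.2.
Qed.

(** A convolution is a superposition of translates of f, which all have the same energy.
    Integrability of g controls the superposition; its square integrability makes the convolution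
    integral converge at every point. *)
Lemma energy_convol_lty f g : square_integrable (leb n) f ->
  cintegrable (leb n) g -> square_integrable (leb n) g ->
  (energy (leb n) (convol f g) < +oo)%E.
Proof.
move=> If Ig Ig2.
apply: (superposition_energy_lty (m1 := leb n) (m2 := leb n)
  (h := fun z : V * V => f (z.1 - z.2)) (g := g) (M := fine (energy (leb n) f))) => //.
- exact: cmeas_translates If.1.
- by move=> y; exact: translates_energy.
- by move=> x; exact: cintegrable_convol.
Qed.

Lemma square_integrable_convol f g : square_integrable (leb n) f ->
  cintegrable (leb n) g -> square_integrable (leb n) g ->
  square_integrable (leb n) (convol f g).
Proof.
move=> If Ig Ig2; split; last exact: energy_convol_lty.
by apply: cmeas_convol; [exact: If.1|exact: Ig2.1].
Qed.

(** No power of 2 pi appears, because K is the normalized transform of f while [fourier] is not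
    normalized. *)
Lemma energy_convol_step f K g : step f K ->
  cintegrable (leb n) g -> square_integrable (leb n) g ->
  energy (leb n) (convol f g) = energy (leb n) (fun w => K w * fourier g w).
Proof.
move=> sf Ig Ig2; have [If IK] := step_square_integrable sf.
have Icis w := cintegrable_fourier w Ig.
transitivity (energy (leb n) (fun w => cint (leb n)
    (fun y => (cis (dotp y w) * K w) * g y))).
  apply: (gram_energy (m0 := leb n) (m1 := leb n) (m2 := leb n)
    (h1 := fun z : V * V => f (z.1 - z.2))
    (h2 := fun z : V * V => cis (dotp z.2 z.1) * K z.1)
    (M1 := fine (energy (leb n) f)) (M2 := fine (energy (leb n) K))) => //.
  - exact: cmeas_translates If.1.
  - apply: cmeasM; first by apply: cmeas_cis; exact: measurable_dotp.
    exact: (cmeas_comp IK.1 measurable_fst).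
  - by move=> y; exact: translates_energy.
  - move=> y; rewrite (energy_modulate K y) fineK//.
    by rewrite ge0_fin_numE ?energy_ge0//; exact: IK.2.
  - by move=> x; exact: cintegrable_convol.
  - move=> w /=; have := cintegrableZl (K w) (Icis w).
    by congr cintegrable; apply/funext => y; ring.
  - by move=> y y'; exact: step_gram.
congr energy; apply/funext => w; rewrite fourierE -cintZl//.
by congr cint; apply/funext => y; ring.
Qed.

End convolution.

Section limits.
Context {R : realType}.

Lemma limn_einf_le (u : (\bar R)^nat) (B : \bar R) k0 :
  (forall k, (k0 <= k)%N -> (u k <= B)%E) -> (limn_einf u <= B)%E.
Proof.
move=> uB; rewrite limn_einf_lim; apply: lime_le; first exact: is_cvg_einfs.
apply: nearW => k; apply: le_trans (uB (maxn k k0) (leq_maxr _ _)).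
by apply: ereal_inf_lbound; exists (maxn k k0) => //=; exact: leq_maxl.
Qed.

Lemma cvg_harmonic_bound (u : R^nat) (l A : R) :
  (forall k, `|l - u k| <= A * k.+1%:R^-1) -> u @ \oo --> l.
Proof.
move=> ul; apply: cvg_sub0 (cvg_cst l); apply: norm_cvg0.
apply: (@squeeze_cvgr _ _ _ _ (cst 0) (fun k => A * k.+1%:R^-1)).
- by apply: nearW => k /=; rewrite normr_ge0 distrC ul.
- exact: cvg_cst.
- by rewrite -(mulr0 A); apply: cvgMr; exact: cvg_harmonic.
Qed.

End limits.

(** * Convolutions of L^2 approximations *)

Section convolution_limits.
Context {R : realType} {n : nat}.
Local Notation V := 'rV[R]_n.
Implicit Types (f g h s : V -> R[i]).

(** Weighted form of 2ab <= a^2 + b^2, with u multiplied and v divided by the square root of a. The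
    free weight does what optimization does in the proof of Cauchy-Schwarz. *)
Lemma integral_normcM_le (d : measure_display) (T : measurableType d)
    (mu : {measure set T -> \bar R}) (u v : T -> R[i]) (a e G : R) :
  square_integrable mu u -> square_integrable mu v -> 0 < a ->
  (energy mu u <= e%:E)%E -> (energy mu v <= G%:E)%E ->
  (\int[mu]_x (Normc.normc (u x * v x))%:E <= ((a * e + G / a) / 2)%:E)%E.
Proof.
move=> Iu Iv a0 ue vG.
have mu' := (measurable_EFinP _ _).2 (measurable_sqn Iu.1).
have mv' := (measurable_EFinP _ _).2 (measurable_sqn Iv.1).
apply: (@le_trans _ _ (\int[mu]_x ((a / 2)%:E * (sqn (u x))%:E +
    (a^-1 / 2)%:E * (sqn (v x))%:E))%E).
  apply: ge0_le_integral => //.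
  - by move=> x _; rewrite lee_fin normc_ge0.
  - apply/measurable_EFinP; apply: measurable_normc.
    by apply: cmeasM; [exact: Iu.1|exact: Iv.1].
  - by apply: emeasurable_funD; exact: measurable_funeM.
  move=> x _; rewrite -!EFinM -EFinD lee_fin.
  have b0 : 0 < Num.sqrt a by rewrite sqrtr_gt0.
  have bE : a = Num.sqrt a ^+ 2 by rewrite sqr_sqrtr// ltW.
  have -> : u x * v x = ((Num.sqrt a)%:C * u x) * ((Num.sqrt a)^-1%:C * v x).
    by rewrite mulrACA -rmorphM divff ?gt_eqF// mul1r.
  apply: le_trans (normcM_le _ _) _; rewrite !sqnM !sqn_real exprVn -bE.
  by rewrite le_eqVlt; apply/orP; left; apply/eqP; field; rewrite gt_eqF.
have nn (c : R) (w : T -> R[i]) x : 0 < c -> (0 <= c%:E * (sqn (w x))%:E)%E.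
  by move=> c0; rewrite mule_ge0// lee_fin ?sqn_ge0 ?ltW.
have a2 : 0 < a / 2 by rewrite divr_gt0.
have ai2 : 0 < a^-1 / 2 by rewrite divr_gt0 ?invr_gt0.
rewrite ge0_integralD//; last 4 first.
- by move=> x _; exact: nn.
- exact: measurable_funeM.
- by move=> x _; exact: nn.
- exact: measurable_funeM.
rewrite !ge0_integralZl//; last 4 first.
- by move=> x _; rewrite lee_fin sqn_ge0.
- by rewrite lee_fin ltW.
- by move=> x _; rewrite lee_fin sqn_ge0.
- by rewrite lee_fin ltW.
apply: (@le_trans _ _ ((a / 2)%:E * e%:E + (a^-1 / 2)%:E * G%:E)%E).
  by rewrite leeD// lee_wpmul2l// lee_fin ltW.
rewrite -!EFinM -EFinD lee_fin le_eqVlt; apply/orP; left; apply/eqP; field.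
by rewrite gt_eqF.
Qed.

Lemma cint_le_normc (d : measure_display) (T : measurableType d)
    (mu : {measure set T -> \bar R}) (u : T -> R[i]) (B : R) :
  cintegrable mu u -> (\int[mu]_x (Normc.normc (u x))%:E <= B%:E)%E ->
  `|complex.Re (cint mu u)| <= B /\ `|complex.Im (cint mu u)| <= B.
Proof.
move=> Iu uB; have Inu := integrable_normc Iu; have [I1 I2] := Iu.
have H (w : T -> R) : mu.-integrable setT (EFin \o w) ->
    (forall x, `|w x| <= Normc.normc (u x)) -> `|\int[mu]_x w x| <= B.
  move=> Iw wu; rewrite -lee_fin; apply: le_trans uB.
  rewrite EFin_normr_Rintegral//; apply: le_trans (le_abse_integral _ _ _) _ => //.
    exact: measurable_int Iw.
  apply: ge0_le_integral => //.
  - by apply: measurableT_comp => //; exact: measurable_int Iw.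
  - exact: measurable_int Inu.
  - by move=> x _; rewrite lee_fin.
split.
- by apply: (H (fun x => complex.Re (u x)) I1) => x; exact: Re_le_normc.
- by apply: (H (fun x => complex.Im (u x)) I2) => x; exact: Im_le_normc.
Qed.

(** Convergence holds at every point, with no passage to a subsequence: the convolution is evaluated
    by pairing a reflected translate with g in L^2. *)
Lemma cvg_sqn_convol f (s_ : nat -> V -> R[i]) g x :
  square_integrable (leb n) f -> square_integrable (leb n) g ->
  (forall k, square_integrable (leb n) (s_ k)) ->
  (forall k, energy (leb n) (fun x => f x - s_ k x)%R <= (k.+1%:R ^- 2)%:E)%E ->
  (sqn (convol (s_ k) g x))%:E @[k --> \oo] --> (sqn (convol f g x))%:E.
Proof.
move=> If Ig Is fs.
pose G := fine (energy (leb n) g).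
have GE : energy (leb n) g = G%:E.
  by rewrite fineK// ge0_fin_numE ?energy_ge0//; exact: Ig.2.
have Id k : square_integrable (leb n) (fun x => f x - s_ k x).
  by apply: square_integrableD => //; exact: square_integrableN.
have dE k : convol f g x - convol (s_ k) g x = convol (fun y => f y - s_ k y) g x.
  rewrite convolDl//; last exact: square_integrableN.
  by rewrite convolNl.
have bd k : `|complex.Re (convol (fun y => f y - s_ k y) g x)| <=
      ((1 + G) / 2) * k.+1%:R^-1 /\
    `|complex.Im (convol (fun y => f y - s_ k y) g x)| <=
      ((1 + G) / 2) * k.+1%:R^-1.
  rewrite convolE; apply: cint_le_normc; first exact: (cintegrable_convol x (Id k) Ig).
  have k0 : 0 < k.+1%:R :> R by [].
  (* With weight k+1 and squared error (k+1)^-2, both terms of the bound are of order 1/(k+1). *)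
  apply: le_trans (integral_normcM_le (a := k.+1%:R) (e := k.+1%:R ^- 2)
    (square_integrable_reflect x (Id k)) Ig k0 _ (_ : _ <= G%:E)%E) _.
  - by rewrite (energy_reflect x (Id k).1).
  - by rewrite GE.
  - rewrite lee_fin le_eqVlt; apply/orP; left; apply/eqP; field.
    by rewrite gt_eqF.
have cRe : complex.Re (convol (s_ k) g x) @[k --> \oo] --> complex.Re (convol f g x).
  apply: (@cvg_harmonic_bound _ _ _ ((1 + G) / 2)) => k.
  by have [+ _] := bd k; rewrite -dE ReD ReN.
have cIm : complex.Im (convol (s_ k) g x) @[k --> \oo] --> complex.Im (convol f g x).
  apply: (@cvg_harmonic_bound _ _ _ ((1 + G) / 2)) => k.
  by have [_] := bd k; rewrite -dE ImD ImN.
apply: cvg_EFin; first exact: nearW.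
rewrite /sqn /comp /=; under eq_fun do rewrite !expr2.
by rewrite !expr2; apply: cvgD; exact: cvgM.
Qed.

(** The difference of the two sides is the squared modulus of sqrt(t) z - w / sqrt(t). Unlike in
    [sqnD_le], the factor of the first term can be brought close to 1, which keeps the constant C
    sharp in the limit. *)
Lemma sqnD_weighted_le (z w : R[i]) (t : R) : 0 < t ->
  sqn (z + w) <= (1 + t) * sqn z + (1 + t^-1) * sqn w.
Proof.
move=> t0; have b0 : 0 < Num.sqrt t by rewrite sqrtr_gt0.
have tE : t = Num.sqrt t ^+ 2 by rewrite sqr_sqrtr// ltW.
rewrite -subr_ge0.
rewrite (_ : _ - _ = sqn ((Num.sqrt t)%:C * z - (Num.sqrt t)^-1%:C * w)) ?sqn_ge0//.
rewrite {1 2}tE /sqn !ReImE /=; field; rewrite gt_eqF//.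
Qed.

Lemma energyD_weighted_le f g (t : R) : 0 < t -> cmeas f -> cmeas g ->
  (energy (leb n) (fun x => f x + g x)%R <=
   (1 + t)%:E * energy (leb n) f + (1 + t^-1)%:E * energy (leb n) g)%E.
Proof.
move=> t0 mf mg.
have mf' := (measurable_EFinP _ _).2 (measurable_sqn mf).
have mg' := (measurable_EFinP _ _).2 (measurable_sqn mg).
have t1 : 0 <= 1 + t by rewrite addr_ge0// ltW.
have t2 : 0 <= 1 + t^-1 by rewrite addr_ge0// invr_ge0 ltW.
have nn (u : V -> R[i]) x : setT x -> (0 <= (sqn (u x))%:E)%E.
  by move=> _; rewrite lee_fin sqn_ge0.
rewrite /energy -!ge0_integralZl//; try by [exact: nn|rewrite lee_fin].
have nn' (c : R) (u : V -> R[i]) x : 0 <= c -> setT x -> (0 <= c%:E * (sqn (u x))%:E)%E.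
  by move=> c0 xT; rewrite mule_ge0// nn.
rewrite -ge0_integralD//; last 4 first.
- by move=> x; exact: nn'.
- exact: measurable_funeM.
- by move=> x; exact: nn'.
- exact: measurable_funeM.
apply: ge0_le_integral => //.
- by move=> x _; rewrite lee_fin sqn_ge0.
- by apply/measurable_EFinP; apply: measurable_sqn; exact: cmeasD.
- by apply: emeasurable_funD; exact: measurable_funeM.
by move=> x _; rewrite -!EFinM -EFinD lee_fin sqnD_weighted_le.
Qed.

End convolution_limits.

(** * The Littlewood-Paley identity *)

(* [q] and [c * a] satisfy the parallelogram law and agree at the point [s], and
   [q <= c * a]: so their defect at [s + h] is at most twice that at [h]. *)
Lemma parallelogram_bound (R : realType) (a1 a2 a3 a4 q1 q2 q3 q4 : \bar R)
    (c e : R) : 0 < c ->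
  a1 \is a fin_num -> a2 \is a fin_num -> a3 \is a fin_num -> a4 \is a fin_num ->
  q1 \is a fin_num -> q2 \is a fin_num -> q3 \is a fin_num -> q4 \is a fin_num ->
  (q1 + q2 = 2%:E * q3 + 2%:E * q4)%E -> (a1 + a2 = 2%:E * a3 + 2%:E * a4)%E ->
  (q3 = c%:E * a3)%E -> (q2 <= c%:E * a2)%E -> (0 <= q4)%E ->
  (a4 <= (e / (2 * c))%:E)%E ->
  (c%:E * a1 <= q1 + e%:E)%E.
Proof.
case: a1 => [a1| |]//; case: a2 => [a2| |]//; case: a3 => [a3| |]//;
case: a4 => [a4| |]//; case: q1 => [q1| |]//; case: q2 => [q2| |]//;
case: q3 => [q3| |]//; case: q4 => [q4| |]// c0 _ _ _ _ _ _ _ _.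
rewrite -!EFinM -!EFinD !lee_fin => -[Eq] -[Ea] -[q3E] q2le q40.
rewrite ler_pdivlMr ?mulr_gt0// => a4e.
(* Likewise q1 = 2 q3 + 2 q4 - q2 >= 2 c a3 - c a2, so the defect at the first point is at most 2 c
   a4 <= e. *)
have -> : c * a1 = 2 * (c * a3) + 2 * (c * a4) - c * a2.
  by rewrite mulrCA (mulrCA 2 c) -mulrDr -mulrBr -Ea addrK.
lra.
Qed.

Lemma integral_parallelogram d (T : measurableType d) (R : realType)
    (mu : {measure set T -> \bar R}) (A B U W : T -> \bar R) :
  measurable_fun setT A -> measurable_fun setT B ->
  measurable_fun setT U -> measurable_fun setT W ->
  (forall x, 0 <= A x)%E -> (forall x, 0 <= B x)%E ->
  (forall x, 0 <= U x)%E -> (forall x, 0 <= W x)%E ->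
  (forall x, A x + B x = 2%:E * U x + 2%:E * W x)%E ->
  (\int[mu]_x A x + \int[mu]_x B x =
   2%:E * \int[mu]_x U x + 2%:E * \int[mu]_x W x)%E.
Proof.
move=> mA mB mU mW A0 B0 U0 W0 ABUW.
rewrite -ge0_integralD// -!ge0_integralZl// -ge0_integralD//.
- by apply: eq_integral => x _.
- by move=> x _; rewrite mule_ge0.
- exact: measurable_funeM.
- by move=> x _; rewrite mule_ge0.
- exact: measurable_funeM.
Qed.

Section littlewood_paley_identity.
Context d (L : measurableType d) {R : realType} {n : nat}.
Local Notation V := 'rV[R]_n.
Variable nu : {sigma_finite_measure set L -> \bar R}.
Variables (g : L * V -> R[i]) (C : R).
Hypothesis n_gt0 : (0 < n)%N.
Hypothesis C_gt0 : 0 < C.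
Hypothesis mg : cmeas g.
Hypothesis Ig : forall l, cintegrable (leb n) (fun x => g (l, x)).
Hypothesis Ig2 : forall l, square_integrable (leb n) (fun x => g (l, x)).
Hypothesis LP : forall w : V, w != 0 ->
  (\int[nu]_l (sqn (fourier (fun x => g (l, x)) w))%:E = C%:E)%E.
Implicit Types (f s K : V -> R[i]).

Let gl l x := g (l, x).
(** The measure [nu] on the scales will be Lebesgue measure or a counting measure; any further
    density is absorbed into the kernels g. *)
Let Q f := (\int[nu]_l energy (leb n) (convol f (gl l)))%E.

(** [LP] says nothing at the frequency 0, which must therefore be negligible. Here n > 0 enters: in
    dimension 0 the origin has mass 1. *)
Lemma leb_set0 : leb n [set 0 : V] = 0%E.
Proof.
have -> : leb n [set 0 : V] =
    (\prod_(i < n) @lebesgue_measure R [set (0 : R)%R])%E.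
  rewrite -leb_rectangle => [|i]; last exact: measurable_set1.
  congr leb; apply/seteqP; split=> x /=; first by move=> -> i; rewrite mxE.
  by move=> x0; apply/rowP => i; rewrite mxE; have := x0 i; rewrite (ord1 ord0).
rewrite (eq_bigr (fun=> 0%:E)) => [|i _]; last exact: lebesgue_measure_set1.
by rewrite prodEFin prodr_const card_ord expr0n gtn_eqF.
Qed.

Lemma measurable_set0_rV : measurable [set 0 : V].
Proof.
rewrite (_ : [set 0] = [set x : V | forall i, [set 0 : R] (x ord0 i)]).
  by apply: (@measurable_rectangle _ _ (fun=> [set 0 : R])) => i; exact: measurable_set1.
apply/seteqP; split=> x /=; first by move=> -> i; rewrite mxE.
by move=> x0; apply/rowP => i; rewrite mxE; have := x0 i; rewrite (ord1 ord0).
Qed.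

Let mconvol f : cmeas f -> cmeas (fun z : L * V => convol f (gl z.1) z.2).
Proof.
move=> mf; apply: (cmeas_convol_param (f := fun z : L * V => f z.2) _ mg).
exact: (cmeas_comp mf measurable_snd).
Qed.

Let mQ f : cmeas f ->
  measurable_fun setT (fun l => energy (leb n) (convol f (gl l))).
Proof. by move=> mf; exact: (measurable_energy (leb n) (mconvol mf)). Qed.

Lemma littlewood_paley_step f K : step f K -> Q f = (C%:E * energy (leb n) f)%E.
Proof.
move=> sf; have [If IK] := step_square_integrable sf.
have mF := cmeas_fourier_param mg.
have mK : cmeas (fun z : L * V => K z.2) by exact: (cmeas_comp IK.1 measurable_snd).
pose F (z : L * V) := (sqn (K z.2 * fourier (gl z.1) z.2))%:E.
have mEF : measurable_fun setT F.
  by apply/measurable_EFinP; apply: measurable_sqn; exact: cmeasM.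
transitivity (\int[nu]_l \int[leb n]_w F (l, w))%E.
  by apply: eq_integral => l _; rewrite (energy_convol_step sf (Ig l) (Ig2 l)).
rewrite (fubini_tonelli (m1 := nu) (m2 := leb n) F mEF); last first.
  by move=> z; rewrite lee_fin sqn_ge0.
rewrite (energy_step sf) /energy -ge0_integralZl//; last 3 first.
- by apply/measurable_EFinP; apply: measurable_sqn; exact: IK.1.
- by move=> w _; rewrite lee_fin sqn_ge0.
- by rewrite lee_fin ltW.
apply: ge0_ae_eq_integral => //.
- apply: (measurable_fun_fubini_tonelli_G (m1 := nu) F mEF).
  by move=> z; rewrite lee_fin sqn_ge0.
- apply: measurable_funeM; apply/measurable_EFinP; apply: measurable_sqn.
  exact: IK.1.
- by move=> w _; apply: integral_ge0 => l _; rewrite lee_fin sqn_ge0.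
- by move=> w _; rewrite -EFinM lee_fin mulr_ge0 ?sqn_ge0 ?ltW.
exists [set 0]; split; [exact: measurable_set0_rV|exact: leb_set0|].
move=> w /=; apply: contra_notP => /eqP w0 _.
rewrite /fubini_G /F /=.
under eq_integral do rewrite sqnM EFinM.
rewrite ge0_integralZl//.
- by rewrite LP// muleC.
- apply/measurable_EFinP; apply: measurable_sqn.
  exact: (cmeas_comp (phi := fun l => (l, w)) mF (measurable_pair2 w)).
- by move=> l _; rewrite lee_fin sqn_ge0.
- by rewrite lee_fin sqn_ge0.
Qed.

(** Fatou is applied twice, in x at a fixed scale and then over the scales, along step functions
    converging to f with the rate that [cvg_sqn_convol] asks for. *)
Lemma littlewood_paley_le f : square_integrable (leb n) f ->
  (Q f <= C%:E * energy (leb n) f)%E.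
Proof.
move=> If.
have /choice[s_ sP] : forall k, exists s, (exists K, step s K) /\
    (energy (leb n) (fun x => f x - s x)%R <= (k.+1%:R ^- 2)%:E)%E.
  move=> k; have k2 : 0 < k.+1%:R ^- 2 :> R by rewrite invr_gt0 exprn_gt0.
  have [s [K [sK fs]]] := (approximable_square_integrable If).2 _ k2.
  by exists s; split => //; exists K.
have Is k : square_integrable (leb n) (s_ k).
  by have [[K sK] _] := sP k; exact: (step_square_integrable sK).1.
have fs k := (sP k).2.
pose E := fine (energy (leb n) f).
have EE : energy (leb n) f = E%:E.
  by rewrite fineK// ge0_fin_numE ?energy_ge0//; exact: If.2.
have E0 : 0 <= E by rewrite -lee_fin -EE energy_ge0.
apply: (@le_trans _ _ (limn_einf (fun k => Q (s_ k)))).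
  apply: (@le_trans _ _ (\int[nu]_l
      limn_einf (fun k => energy (leb n) (convol (s_ k) (gl l))))%E); last first.
    apply: fatou => //.
    - by move=> k; apply: mQ; exact: (Is k).1.
    - by move=> k l _; exact: energy_ge0.
  apply: ge0_le_integral => //.
  - by move=> l _; exact: energy_ge0.
  - by apply: mQ; exact: If.1.
  - rewrite /limn_einf; apply: measurableT_comp => //.
    apply: measurable_fun_limn_esup => k; apply: measurableT_comp => //.
    by apply: mQ; exact: (Is k).1.
  move=> l _.
  apply: (@le_trans _ _ (\int[leb n]_x
      limn_einf (fun k => (sqn (convol (s_ k) (gl l) x))%:E))%E); last first.
    apply: fatou => //.
    - move=> k; apply/measurable_EFinP; apply: measurable_sqn.
      by apply: cmeas_convol; [exact: (Is k).1|exact: (Ig2 l).1].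
    - by move=> k x _; rewrite lee_fin sqn_ge0.
  rewrite le_eqVlt; apply/orP; left; apply/eqP; apply: eq_integral => x _.
  have cv := @cvg_sqn_convol _ _ f s_ (gl l) x If (Ig2 l) Is fs.
  rewrite is_cvg_limn_einfE; last by apply/cvg_ex; eexists; exact: cv.
  by apply/esym/cvg_lim.
rewrite EE; apply/lee_addgt0Pr => e e0.
(* Chosen so that C ((1 + t) E + t) = C E + e. *)
pose t := e / (C * (E + 1)).
have CE0 : 0 < C * (E + 1) by rewrite mulr_gt0// ltr_wpDl.
have t0 : 0 < t by rewrite divr_gt0.
(* From here on (1 + 1/t) / (k+1)^2 <= t. *)
pose k0 := Num.bound ((1 + t^-1) / t).
apply: (@limn_einf_le _ _ _ k0) => k k0k.
have [[K sK] _] := sP k; rewrite (littlewood_paley_step sK).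
have sE : (energy (leb n) (s_ k) <= ((1 + t) * E + t)%:E)%E.
  have -> : s_ k = (fun x => f x + - (f x - s_ k x)).
    by apply/funext => x; rewrite opprB addrC subrK.
  have mfs : cmeas (fun x => f x - s_ k x).
    by apply: cmeasD; [exact: If.1|apply: cmeasN; exact: (Is k).1].
  apply: le_trans (energyD_weighted_le t0 If.1 (cmeasN mfs)) _.
  rewrite energyN EE [leRHS]EFinD [X in (_ <= X + _)%E]EFinM leeD//.
  apply: (@le_trans _ _ ((1 + t^-1)%:E * (k.+1%:R ^- 2)%:E)%E).
    by rewrite lee_wpmul2l// lee_fin addr_ge0// invr_ge0 ltW.
  rewrite -EFinM lee_fin ler_pdivrMr ?exprn_gt0//.
  rewrite mulrC -ler_pdivrMr//.
  have b0 : 0 <= (1 + t^-1) / t by rewrite divr_ge0 ?addr_ge0 ?invr_ge0// ltW.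
  apply: le_trans (ltW (archi_boundP b0)) _.
  rewrite -/k0 -natrX ler_nat (leq_trans k0k)//.
  by rewrite (leq_trans (leqnSn k))// -mulnn leq_pmulr.
apply: (@le_trans _ _ (C%:E * ((1 + t) * E + t)%:E)%E).
  by rewrite lee_wpmul2l// lee_fin ltW.
rewrite -!EFinM -EFinD lee_fin le_eqVlt; apply/orP; left; apply/eqP.
by rewrite /t; field; rewrite !gt_eqF// ltr_wpDl.
Qed.

(** [littlewood_paley_le] makes all values of Q finite, as the subtractions in [parallelogram_bound]
    require. That lemma is applied to f = s + h with s a step function and h small. *)
Theorem littlewood_paley_energy f : square_integrable (leb n) f ->
  Q f = (C%:E * energy (leb n) f)%E.
Proof.
move=> If; apply/eqP; rewrite eq_le littlewood_paley_le//=.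
have fin (u : V -> R[i]) : square_integrable (leb n) u -> energy (leb n) u \is a fin_num.
  by move=> Iu; rewrite ge0_fin_numE ?energy_ge0//; exact: Iu.2.
have Q0 u : (0 <= Q u)%E by apply: integral_ge0 => l _; exact: energy_ge0.
have Qfin (u : V -> R[i]) : square_integrable (leb n) u -> Q u \is a fin_num.
  move=> Iu; rewrite ge0_fin_numE//; apply: le_lt_trans (littlewood_paley_le Iu) _.
  by rewrite lte_mul_pinfty ?lee_fin ?ltW//; exact: Iu.2.
apply/lee_addgt0Pr => e e0.
have e2 : 0 < e / (2 * C) by rewrite divr_gt0// mulr_gt0.
have [s [K [sK fs]]] := (approximable_square_integrable If).2 _ e2.
have Is := (step_square_integrable sK).1.
pose h x := f x - s x.
have Ih : square_integrable (leb n) h.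
  by apply: square_integrableD => //; exact: square_integrableN.
have Ish : square_integrable (leb n) (fun x => s x - h x).
  by apply: square_integrableD => //; exact: square_integrableN.
have fE : f = (fun x => s x + h x) by apply/funext => x; rewrite /h addrC subrK.
have QP : (Q f + Q (fun x => s x - h x)%R = 2%:E * Q s + 2%:E * Q h)%E.
  apply: integral_parallelogram; try by move=> l; exact: energy_ge0.
  - by apply: mQ; exact: If.1.
  - by apply: mQ; exact: Ish.1.
  - by apply: mQ; exact: Is.1.
  - by apply: mQ; exact: Ih.1.
  move=> l.
  have mc u : square_integrable (leb n) u -> cmeas (convol u (gl l)).
    by move=> Iu; apply: cmeas_convol; [exact: Iu.1|exact: (Ig2 l).1].
  rewrite -(energy_parallelogram (leb n) (mc _ Is) (mc _ Ih)).
  congr (_ + _)%E; congr energy; apply/funext => x.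
    by rewrite fE convolDl//; exact: Ig2.
  rewrite convolDl; [|exact: Is|exact: square_integrableN|exact: Ig2].
  by rewrite convolNl//; exact: Ig2.
have NP := energy_parallelogram (leb n) Is.1 Ih.1.
rewrite -fE in NP.
apply: (parallelogram_bound C_gt0 (fin _ If) (fin _ Ish) (fin _ Is) (fin _ Ih)
  (Qfin _ If) (Qfin _ Ish) (Qfin _ Is) (Qfin _ Ih) QP NP).
- exact: littlewood_paley_step sK.
- exact: littlewood_paley_le.
- exact: Q0.
- exact: fs.
Qed.

End littlewood_paley_identity.

(** * Scattering transforms *)

Section Lp_norms.
Context {R : realType} {n : nat}.
Local Notation V := 'rV[R]_n.
Implicit Types (f g k psi : V -> R[i]).

Lemma Lpnorm2E f : Lpnorm 2 f = ((energy (leb n) f) `^ 2^-1)%E.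
Proof.
rewrite /Lpnorm unlock /energy; congr (_ `^ _)%E.
apply: eq_integral => x _; rewrite gee0_abs ?lee_fin ?normc_ge0//.
by rewrite poweR_EFin powR_mulrn ?normc_ge0// sqr_normc.
Qed.

Lemma sqr_Lpnorm2 f : (Lpnorm 2 f ^+ 2)%E = energy (leb n) f.
Proof.
by rewrite Lpnorm2E poweR12_sqrt ?energy_ge0// sqr_sqrte// energy_ge0.
Qed.

Lemma memLp2P f : memLp 2 f <-> square_integrable (leb n) f.
Proof.
rewrite /memLp /square_integrable Lpnorm2E; split=> -[mf fy]; split=> //.
  rewrite ltey; apply/eqP => E; move: fy; rewrite E poweRyr ?ltxx//.
by apply: poweR_lty.
Qed.

Lemma memLp1_cintegrable f : memLp 1 f -> cintegrable (leb n) f.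
Proof.
rewrite /memLp /Lpnorm Lnorm1 => -[mf fy]; apply/cintegrableP; split => //.
by move: fy; under eq_integral do rewrite gee0_abs ?lee_fin ?normc_ge0//.
Qed.

End Lp_norms.

(** * Dilations of the wavelet and their Fourier transforms *)

Section dilations.
Context {R : realType} {n : nat}.
Local Notation V := 'rV[R]_n.
Implicit Types (f g psi : V -> R[i]) (c : R) (w x : V).

(** The common part of [dilate_cont] and [dilate_dyad], which differ from it by a scalar factor. *)
Definition rescale c psi x := psi (c^-1 *: x).

Let rescaleE c psi : rescale c psi = psi \o (fun x => c^-1 *: x + 0).
Proof. by apply/funext => x; rewrite /rescale /= addr0. Qed.

Lemma square_integrable_rescale c psi : 0 < c ->
  square_integrable (leb n) psi -> square_integrable (leb n) (rescale c psi).
Proof.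
move=> c0 Ipsi; rewrite rescaleE; apply: square_integrable_affine => //.
by rewrite invr_eq0 gt_eqF.
Qed.

Lemma cintegrable_rescale c psi : 0 < c ->
  cintegrable (leb n) psi -> cintegrable (leb n) (rescale c psi).
Proof.
move=> c0 Ipsi; rewrite rescaleE; apply: cintegrable_affine => //.
by rewrite invr_eq0 gt_eqF.
Qed.

Lemma dotpZ c x w : dotp (c *: x) w = c * dotp x w.
Proof. by rewrite /dotp mulr_sumr; apply: eq_bigr => i _; rewrite mxE mulrA. Qed.

Lemma dotpZr c x w : dotp x (c *: w) = c * dotp x w.
Proof. by rewrite /dotp mulr_sumr; apply: eq_bigr => i _; rewrite mxE mulrCA. Qed.

Lemma fourier_rescale c psi w : 0 < c -> cintegrable (leb n) psi ->
  fourier (rescale c psi) w = (c ^+ n)%:C * fourier psi (c *: w).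
Proof.
move=> c0 Ipsi; rewrite !fourierE.
have c1 : c^-1 != 0 by rewrite invr_eq0 gt_eqF.
rewrite (cint_affine 0 c1 (cintegrable_fourier (c *: w) Ipsi)).
rewrite mulrA -rmorphM ger0_norm ?invr_ge0 ?ltW// exprVn divff ?mul1r; last first.
  by rewrite expf_neq0// gt_eqF.
congr cint; apply/funext => x; rewrite /= addr0 dotpZ dotpZr mulrA mulVf ?mul1r//.
by rewrite gt_eqF.
Qed.

Lemma fourierZ (a : R[i]) psi w : cintegrable (leb n) psi ->
  fourier (fun x => a * psi x) w = a * fourier psi w.
Proof.
move=> Ipsi; rewrite !fourierE -cintZl; last exact: cintegrable_fourier.
by congr cint; apply/funext => x; rewrite mulrA.
Qed.

Lemma convolZr (a : R[i]) f g x : square_integrable (leb n) f ->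
  square_integrable (leb n) g -> convol f (fun y => a * g y) x = a * convol f g x.
Proof.
move=> If Ig; rewrite !convolE -cintZl; last exact: cintegrable_convol.
by congr cint; apply/funext => y; rewrite mulrCA.
Qed.

Lemma dilate_contE psi c :
  dilate_cont psi c = fun x => (c `^ (- (n%:R / 2)))%:C * rescale c psi x.
Proof. by []. Qed.

Lemma dilate_dyadE psi j :
  dilate_dyad psi j =
  fun x => ((2 : R) ^ (- (n%:Z * j)))%:C * rescale ((2 : R) ^ j) psi x.
Proof. by apply/funext => x; rewrite /rescale /dilate_dyad invr_expz. Qed.

(** The L^2 normalization leaves a factor c^n; it turns the measure dl / l^(n+1) of the scattering
    norm into the dl / l of the Littlewood-Paley condition. *)
Lemma sqn_fourier_dilate_cont psi c w : 0 < c -> cintegrable (leb n) psi ->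
  sqn (fourier (dilate_cont psi c) w) = c ^+ n * sqn (fourier psi (c *: w)).
Proof.
move=> c0 Ipsi; rewrite dilate_contE fourierZ; last exact: cintegrable_rescale.
rewrite fourier_rescale// !sqnM !sqn_real mulrA; congr (_ * _).
rewrite -powR_mulrn ?powR_ge0// -powRrM mulNr mulfVK// powRN powR_mulrn ?ltW//.
by rewrite expr2 mulKf// expf_neq0// gt_eqF.
Qed.

(** With the L^1 normalization the Jacobian cancels exactly, which suits an unweighted sum over
    j. *)
Lemma fourier_dilate_dyad psi j w : cintegrable (leb n) psi ->
  fourier (dilate_dyad psi j) w = fourier psi ((2 : R) ^ j *: w).
Proof.
move=> Ipsi; have j0 : 0 < (2 : R) ^ j by rewrite exprz_gt0.
rewrite dilate_dyadE fourierZ; last exact: cintegrable_rescale.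
rewrite fourier_rescale// mulrA -rmorphM.
have -> : (2 : R) ^ (- (n%:Z * j)) * (2 ^ j) ^+ n = 1.
  by rewrite exprnP exprz_exp -expfzDr// (mulrC j) addNr expr0z.
by rewrite mul1r.
Qed.

Lemma cintegrable_dilate_cont psi c : 0 < c ->
  cintegrable (leb n) psi -> cintegrable (leb n) (dilate_cont psi c).
Proof. by move=> c0 Ipsi; apply: cintegrableZl; exact: cintegrable_rescale. Qed.

Lemma square_integrable_dilate_cont psi c : 0 < c ->
  square_integrable (leb n) psi -> square_integrable (leb n) (dilate_cont psi c).
Proof.
by move=> c0 Ipsi; apply: square_integrableZl; exact: square_integrable_rescale.
Qed.

Lemma cintegrable_dilate_dyad psi j :
  cintegrable (leb n) psi -> cintegrable (leb n) (dilate_dyad psi j).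
Proof.
move=> Ipsi; rewrite dilate_dyadE; apply: cintegrableZl.
by apply: cintegrable_rescale => //; rewrite exprz_gt0.
Qed.

Lemma square_integrable_dilate_dyad psi j :
  square_integrable (leb n) psi -> square_integrable (leb n) (dilate_dyad psi j).
Proof.
move=> Ipsi; rewrite dilate_dyadE; apply: square_integrableZl.
by apply: square_integrable_rescale => //; rewrite exprz_gt0.
Qed.

Lemma cmeas_dilate_cont_param d (P : measurableType d) psi (l : P -> R) :
  cmeas psi -> measurable_fun setT l ->
  cmeas (fun z : P * V => dilate_cont psi (l z.1) z.2).
Proof.
move=> mpsi ml; have ml1 : measurable_fun setT (fun z : P * V => l z.1).
  exact: (measurableT_comp ml measurable_fst).
apply: cmeasM.
- by apply: cmeas_real; exact: (measurableT_comp (measurable_powR _) ml1).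
- apply: (cmeas_comp (phi := fun z : P * V => (l z.1)^-1 *: z.2) mpsi).
  by apply: measurable_rVZ => //; exact: (measurableT_comp measurable_inv ml1).
Qed.

End dilations.

Section nat_counting.
Context (R : realType).

(* [counting] only carries the structure of a sigma-finite content. *)
Definition nat_counting : set nat -> \bar R := counting.

HB.instance Definition _ := Measure.on nat_counting.

HB.instance Definition _ :=
  Measure_isSigmaFinite.Build _ _ _ nat_counting (sigma_finite_counting R).

End nat_counting.

(** * The one-layer identities *)

Section one_layer.
Context {R : realType} {n : nat}.
Local Notation V := 'rV[R]_n.
Implicit Types (f psi : V -> R[i]).

Lemma littlewood_paley_cont_energy psi C f : (0 < n)%N ->
  cintegrable (leb n) psi -> square_integrable (leb n) psi ->
  littlewood_paley_cont psi C -> square_integrable (leb n) f ->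
  (\int[lebesgue_measure]_(l in `]0%R, +oo[)
     (energy (leb n) (convol f (dilate_cont psi l)) * ((l ^+ n.+1)^-1)%:E) =
   C%:E * energy (leb n) f)%E.
Proof.
move=> n0 Ipsi Ipsi2 [C0 LP] If.
(* The density of the measure dl / l^(n+1) is absorbed into the wavelets. *)
pose wt (l : R) : R := if 0 < l then Num.sqrt (l ^+ n.+1)^-1 else 0.
pose g (z : measurableTypeR R * V) : R[i] := (wt z.1)%:C * dilate_cont psi z.1 z.2.
have gE l : (fun x => g (l, x)) = (fun x => (wt l)%:C * dilate_cont psi l x) by [].
have wt2 (l : R) : 0 < l -> wt l ^+ 2 = (l ^+ n.+1)^-1.
  by move=> l0; rewrite /wt l0 sqr_sqrtr// invr_ge0 exprn_ge0// ltW.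
(* For l <= 0 the kernel vanishes: integrals over the half-line become integrals over R, and [Ig]
   and [Ig2] hold at every l. *)
have wt0 (l : R) : ~~ (0 < l) -> wt l = 0 by rewrite /wt => /negbTE ->.
have inI (l : R) : (l \in `]0%R, +oo[%classic) = (0 < l).
  by rewrite mem_setE in_itv/= andbT.
have mwt : measurable_fun setT wt.
  apply: measurable_fun_ifT => //.
    by apply: measurable_fun_ltr => //; exact: measurable_cst.
  have := measurableT_comp (continuous_measurable_fun (@sqrt_continuous R))
    (measurableT_comp (@measurable_inv R) (@exprn_measurable R setT n.+1)).
  exact.
have mg : cmeas g.
  apply: cmeasM.
    by apply: cmeas_real; exact: (measurableT_comp mwt measurable_fst).
  exact: (cmeas_dilate_cont_param (P := measurableTypeR R) (l := id) Ipsi2.1).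
have Ig l : cintegrable (leb n) (fun x => g (l, x)).
  rewrite /g /=; have [l0|/wt0 ->] := boolP (0 < l).
    by apply: cintegrableZl; exact: cintegrable_dilate_cont.
  by under eq_fun do rewrite mul0r; exact: cintegrable0.
have Ig2 l : square_integrable (leb n) (fun x => g (l, x)).
  rewrite /g /=; have [l0|/wt0 ->] := boolP (0 < l).
    by apply: square_integrableZl; exact: square_integrable_dilate_cont.
  by under eq_fun do rewrite mul0r; exact: square_integrable0.
have gLP (w : V) : w != 0 -> (\int[@lebesgue_measure R]_l
    (sqn (fourier (fun x => g (l, x)) w))%:E = C%:E)%E.
  move=> w0; rewrite -(LP w w0) [RHS]integral_mkcond.
  apply: eq_integral => l _; rewrite patchE inI gE.
  have [l0|l0] := ifPn.
    rewrite fourierZ; last exact: cintegrable_dilate_cont.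
    rewrite sqnM sqn_real wt2// sqn_fourier_dilate_cont// sqr_normc; congr (_%:E).
    by rewrite exprS; field; rewrite gt_eqF// expf_neq0// gt_eqF.
  rewrite wt0// fourierE; under eq_fun do rewrite mul0r mul0r.
  by rewrite cint0 sqn0.
rewrite -(littlewood_paley_energy n0 C0 mg Ig Ig2 gLP If) integral_mkcond.
apply: eq_integral => l _; rewrite patchE inI gE.
have [l0|l0] := ifPn.
  have Ik := square_integrable_dilate_cont l0 Ipsi2.
  rewrite muleC -wt2// -sqn_real -energyZl; last exact: cmeas_convol If.1 Ik.1.
  by congr energy; apply/funext => x; rewrite convolZr.
rewrite wt0// -[RHS](_ : energy (leb n) (fun=> 0) = _).
  by rewrite /energy; under eq_integral do rewrite sqn0; rewrite integral0.
congr energy; apply/funext => x; rewrite convolE.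
by under [in RHS]eq_fun do rewrite mul0r mulr0; rewrite cint0.
Qed.

(** The enumeration 0, -1, 1, -2, ... ([Negz k] is -(k+1)), which carries sums over the integers to
    [nat_counting]. *)
Definition int_of_nat (k : nat) : int := if odd k then Negz k./2 else Posz k./2.

Lemma int_of_nat_bij : set_bij [set: nat] [set: int] int_of_nat.
Proof.
split=> //.
- move=> i j _ _; rewrite /int_of_nat.
  case: ifPn => oi; case: ifPn => oj // [ij];
    by rewrite -(odd_double_half i) -(odd_double_half j) ij ?oi ?oj
      ?(negbTE oi) ?(negbTE oj).
- move=> [k|k] _; [exists k.*2|exists k.*2.+1] => //;
    by rewrite /int_of_nat /= odd_double/= ?doubleK ?uphalf_double.
Qed.

Lemma integral_counting_int (a : int -> \bar R) : (forall j, 0 <= a j)%E ->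
  (\int[nat_counting R]_k a (int_of_nat k) = \esum_(j in [set: int]) a j)%E.
Proof.
move=> a0; rewrite ge0_integral_count// nneseries_esumT//.
by apply/esym; exact: reindex_esum int_of_nat_bij.
Qed.

Lemma esum_intZl (c : R) (a : int -> \bar R) : 0 <= c -> (forall j, 0 <= a j)%E ->
  (\esum_(j in [set: int]) (c%:E * a j) = c%:E * \esum_(j in [set: int]) a j)%E.
Proof.
move=> c0 a0; rewrite -!integral_counting_int ?ge0_integralZl//.
by move=> j; rewrite mule_ge0.
Qed.

(** The first factor is countable and discrete, so a preimage is the countable union of its
    slices. *)
Lemma measurable_fun_nat_prod d (T : measurableType d) (u : nat * T -> R) :
  (forall k, measurable_fun setT (fun x => u (k, x))) -> measurable_fun setT u.
Proof.
move=> mu _ B mB; rewrite setTI.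
rewrite (_ : u @^-1` B = \bigcup_k ([set k] `*` ((fun x => u (k, x)) @^-1` B))).
  apply: bigcupT_measurable => k; apply: measurableX => //.
  by rewrite -[X in measurable X]setTI; exact: mu.
apply/seteqP; split=> [[k x] /= uB|[k x] [j _ [/= -> ]]//].
by exists k.
Qed.

Lemma littlewood_paley_dyad_energy psi C f : (0 < n)%N ->
  cintegrable (leb n) psi -> square_integrable (leb n) psi ->
  littlewood_paley_dyad psi C -> square_integrable (leb n) f ->
  (\esum_(j in [set: int]) energy (leb n) (convol f (dilate_dyad psi j)) =
   C%:E * energy (leb n) f)%E.
Proof.
move=> n0 Ipsi Ipsi2 [C0 LP] If.
pose g (z : nat * V) := dilate_dyad psi (int_of_nat z.1) z.2.
have gE k : (fun x => g (k, x)) = dilate_dyad psi (int_of_nat k) by [].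
have Ig2 k : square_integrable (leb n) (fun x => g (k, x)).
  exact: (square_integrable_dilate_dyad (int_of_nat k) Ipsi2).
have mg : cmeas g.
  by split; apply: measurable_fun_nat_prod => k; [exact: (Ig2 k).1.1|exact: (Ig2 k).1.2].
have Ig k : cintegrable (leb n) (fun x => g (k, x)).
  exact: (cintegrable_dilate_dyad (int_of_nat k) Ipsi).
have gLP (w : V) : w != 0 -> (\int[nat_counting R]_k
    (sqn (fourier (fun x => g (k, x)) w))%:E = C%:E)%E.
  move=> w0; rewrite -(LP w w0).
  rewrite -integral_counting_int; last by move=> j; rewrite lee_fin sqr_ge0.
  by apply: eq_integral => k _; rewrite gE sqr_normc fourier_dilate_dyad.
rewrite -(littlewood_paley_energy (nu := nat_counting R) n0 C0 mg Ig Ig2 gLP If).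
by rewrite -integral_counting_int// => j; exact: energy_ge0.
Qed.

End one_layer.

(** * Energy and measurability of cascades *)

Section cascade.
Context {R : realType} {n : nat}.
Local Notation V := 'rV[R]_n.
Implicit Types (f k : V -> R[i]) (s : seq (V -> R[i])).

Let modulus f x : R[i] := (Normc.normc (f x))%:C.

Lemma energy_modulus f : energy (leb n) (modulus f) = energy (leb n) f.
Proof. by apply: eq_integral => x _; rewrite sqn_real sqr_normc. Qed.

Lemma square_integrable_modulus f :
  square_integrable (leb n) f -> square_integrable (leb n) (modulus f).
Proof.
move=> [mf fy]; split; last by rewrite energy_modulus.
by apply: cmeas_real; exact: measurable_normc.
Qed.

(** [cascade] omits the last modulus, but a modulus does not change the energy; hence a recursion
    without a special case for a single kernel. *)
Lemma energy_cascade_cons f k s :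
  energy (leb n) (cascade f (k :: s)) =
  energy (leb n) (cascade (modulus (convol f k)) s).
Proof. by case: s => [|k' s] //=; rewrite energy_modulus. Qed.

Lemma square_integrable_cascade (I : eqType) (K : I -> V -> R[i]) (r : seq I) f :
  (forall i, i \in r ->
    cintegrable (leb n) (K i) /\ square_integrable (leb n) (K i)) ->
  square_integrable (leb n) f ->
  square_integrable (leb n) (cascade f [seq K i | i <- r]).
Proof.
elim: r f => [//|i r IH] f Kr If.
have [Ii Ii2] := Kr i (mem_head _ _).
have Ic := square_integrable_convol If Ii Ii2.
have {}Kr j : j \in r ->
    cintegrable (leb n) (K j) /\ square_integrable (leb n) (K j).
  by move=> jr; apply: Kr; rewrite inE jr orbT.
case: r => [//|j r] in IH Kr *; apply: IH => //.
exact: square_integrable_modulus.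
Qed.

(** The input f is allowed to depend on the parameter because the induction replaces it by the
    output of the first layer, which does. *)
Lemma cmeas_cascade d (P : measurableType d) (I : Type) (K : I -> P * V -> R[i])
    (r : seq I) (f : P * V -> R[i]) :
  (forall i, cmeas (K i)) -> cmeas f ->
  cmeas (fun z : P * V =>
    cascade (fun x => f (z.1, x)) [seq (fun x => K i (z.1, x)) | i <- r] z.2).
Proof.
move=> mK; elim: r f => [|i r IH] f mf /=.
  by under eq_fun do rewrite -surjective_pairing.
have mc := cmeas_convol_param mf (mK i).
case: r => [//|j r] in IH *.
exact: (IH (fun z => (Normc.normc
  (convol (fun x => f (z.1, x)) (fun x => K i (z.1, x)) z.2))%:C)
  (cmeas_real (measurable_normc mc))).
Qed.

Lemma Lpnorm2_fin_num f :
  square_integrable (leb n) f -> Lpnorm 2 f \is a fin_num.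
Proof. by move=> /memLp2P[_]; rewrite ge0_fin_numE// Lnorm_ge0. Qed.

Lemma sqr_abse_Lpnorm2 f : (`|Lpnorm 2 f| ^+ 2)%E = energy (leb n) f.
Proof. by rewrite gee0_abs ?Lnorm_ge0// sqr_Lpnorm2. Qed.

End cascade.

Section scattering.
Context {R : realType} {n : nat}.
Local Notation V := 'rV[R]_n.
Variable psi : V -> R[i].
Hypothesis n_gt0 : (0 < n)%N.
Hypothesis Ipsi : cintegrable (leb n) psi.
Hypothesis Ipsi2 : square_integrable (leb n) psi.
Implicit Types f : V -> R[i].

Lemma square_integrable_scattering_cont m f (l : m.-tuple R) :
  square_integrable (leb n) f -> positive_orthant l ->
  square_integrable (leb n) (cascade f [seq dilate_cont psi li | li <- l]).
Proof.
move=> If l0; apply: square_integrable_cascade => // li /tnthP[i ->].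
split; first exact: cintegrable_dilate_cont.
exact: square_integrable_dilate_cont.
Qed.

Lemma square_integrable_scattering_dyad m f (j : m.-tuple int) :
  square_integrable (leb n) f ->
  square_integrable (leb n) (cascade f [seq dilate_dyad psi ji | ji <- j]).
Proof.
move=> If; apply: square_integrable_cascade => // ji _.
split; first exact: cintegrable_dilate_dyad.
exact: square_integrable_dilate_dyad.
Qed.

Lemma measurable_scattering_cont m f : square_integrable (leb n) f ->
  measurable_fun setT (@scattering_cont R n psi m f).
Proof.
(* The whole tuple of scales is the parameter, and layer i reads its i-th entry. *)
move=> If; pose K (i : 'I_m) (z : m.-tuple R * V) := dilate_cont psi (tnth z.1 i) z.2.
have mF : cmeas (fun z : m.-tuple R * V =>
    cascade f [seq (fun x => K i (z.1, x)) | i <- enum 'I_m] z.2).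
  apply: (@cmeas_cascade _ _ _ (m.-tuple R) _ K (enum 'I_m) (fun z => f z.2)).
    move=> i; apply: (cmeas_dilate_cont_param (l := fun t : m.-tuple R => tnth t i) Ipsi2.1).
    exact: measurable_tnth.
  exact: (cmeas_comp If.1 measurable_snd).
have -> : @scattering_cont R n psi m f = (fun l => ((energy (leb n)
    (fun x => cascade f [seq (fun x => K i (l, x)) | i <- enum 'I_m] x)) `^ 2^-1)%E).
  apply/funext => l; rewrite /scattering_cont Lpnorm2E; congr (energy _ (cascade _ _) `^ _)%E.
  by rewrite -[in LHS](map_tnth_enum l) -map_comp.
exact: (measurableT_comp (measurable_poweR _) (measurable_energy (leb n) mF)).
Qed.

(** The outermost variable of [iter_integral] is the scale of the first layer, so the induction
    hypothesis, for all inputs, applies under the integral to the modulus of the first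
    convolution. *)
Lemma sqnorm_scattering_cont (C : R) m f : littlewood_paley_cont psi C ->
  square_integrable (leb n) f ->
  sqnorm_cont n (@scattering_cont R n psi m f) = ((C ^+ m)%:E * energy (leb n) f)%E.
Proof.
move=> LP; have C0 := LP.1.
have -> : sqnorm_cont n (@scattering_cont R n psi m f) =
    iter_integral n (fun l : m.-tuple R =>
      energy (leb n) (cascade f [seq dilate_cont psi li | li <- l])).
  by congr iter_integral; apply/funext => l; rewrite sqr_abse_Lpnorm2.
elim: m f => [|m IH] f If /=; first by rewrite expr0 mul1e.
rewrite exprSr EFinM -muleA -(littlewood_paley_cont_energy n_gt0 Ipsi Ipsi2 LP If).
rewrite -ge0_integralZl//; last 3 first.
- apply: (@measurable_funS _ _ _ _ setT) => //; apply: emeasurable_funM.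
    apply: (measurable_energy (leb n) (F := fun z : measurableTypeR R * V =>
      convol f (dilate_cont psi z.1) z.2)).
    apply: (cmeas_convol_param (f := fun z : measurableTypeR R * V => f z.2)
      (g := fun z : measurableTypeR R * V => dilate_cont psi z.1 z.2)).
      exact: (cmeas_comp If.1 measurable_snd).
    exact: (cmeas_dilate_cont_param (P := measurableTypeR R) (l := id) Ipsi2.1).
  apply/measurable_EFinP.
  exact: (measurableT_comp (@measurable_inv R) (@exprn_measurable R setT n.+1)).
- move=> l; rewrite /= in_itv/= andbT => l0; rewrite mule_ge0 ?energy_ge0//.
  by rewrite lee_fin invr_ge0 exprn_ge0// ltW.
- by rewrite lee_fin exprn_ge0// ltW.
apply: eq_integral => l; rewrite mem_setE in_itv/= andbT => l0.
rewrite muleA; congr (_ * _)%E.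
under eq_fun do rewrite energy_cascade_cons.
rewrite IH ?energy_modulus//; apply: square_integrable_modulus.
apply: square_integrable_convol => //; first exact: cintegrable_dilate_cont.
exact: square_integrable_dilate_cont.
Qed.

Lemma sqnorm_scattering_dyad (C : R) m f : littlewood_paley_dyad psi C ->
  square_integrable (leb n) f ->
  sqnorm_dyad (@scattering_dyad R n psi m f) = ((C ^+ m)%:E * energy (leb n) f)%E.
Proof.
move=> LP; have C0 := LP.1.
have -> : sqnorm_dyad (@scattering_dyad R n psi m f) =
    \esum_(j in [set: m.-tuple int])
      energy (leb n) (cascade f [seq dilate_dyad psi ji | ji <- j]).
  by apply: eq_esum => l _; rewrite sqr_abse_Lpnorm2.
elim: m f => [|m IH] f If /=.
  rewrite expr0 mul1e (_ : setT = [set [tuple]]) ?esum_set1 ?energy_ge0//.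
  by apply/seteqP; split=> // t _; rewrite (tuple0 t).
rewrite exprSr EFinM -muleA -(littlewood_paley_dyad_energy n_gt0 Ipsi Ipsi2 LP If).
rewrite -esum_intZl ?exprn_ge0 ?(ltW C0)//; last by move=> j; exact: energy_ge0.
(* Splitting off the head of a tuple turns the sum into an iterated one, the first layer being the
   outer sum. *)
pose e (p : int * m.-tuple int) : m.+1.-tuple int := [tuple of p.1 :: p.2].
have e_bij : set_bij (setT `*`` (fun=> setT)) setT e.
  split=> //.
  - move=> [i t] [j u] _ _ /(congr1 val) /= [-> tu]; congr pair; exact: val_inj.
  - move=> t _; exists (thead t, behead_tuple t) => //.
    by rewrite /e /= [RHS]tuple_eta.
rewrite (reindex_esum _ _ _ _ e_bij).
rewrite -(@esum_esum _ _ _ setT (fun=> setT) (fun j (t : m.-tuple int) => energy (leb n)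
  (cascade f [seq dilate_dyad psi ji | ji <- e (j, t)]))); last first.
  by move=> j t _ _; exact: energy_ge0.
apply: eq_esum => j _ /=.
under eq_esum do rewrite energy_cascade_cons.
rewrite IH ?energy_modulus//; apply: square_integrable_modulus.
apply: square_integrable_convol => //; first exact: cintegrable_dilate_dyad.
exact: square_integrable_dilate_dyad.
Qed.

End scattering.

Theorem proposition3 (R : realType) (n m : nat) (psi : 'rV[R]_n -> R[i]) :
  (0 < n)%N -> (1 <= m)%N -> wavelet psi ->
  (exists A eps eps' : R,
    [/\ 0 < A, 0 < eps, 0 < eps',
        forall x : 'rV[R]_n,
          Normc.normc (psi x) <= A * (1 + enorm x) `^ (- n%:R - eps) &
        forall y : 'rV[R]_n, y != 0 ->
          (\int[lebesgue_rV n]_x (Normc.normc (psi (x - y) - psi x))%:E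
             <= (A * enorm y `^ eps')%:E)%E]) ->
  (forall C : R, littlewood_paley_cont psi C ->
     forall f : 'rV[R]_n -> R[i], memLp 2 f ->
       memL2_cont n (@scattering_cont R n psi m f) /\
       sqnorm_cont n (@scattering_cont R n psi m f) =
         ((C ^+ m)%:E * Lpnorm 2 f ^+ 2)%E) /\
  (forall C : R, littlewood_paley_dyad psi C ->
     forall f : 'rV[R]_n -> R[i], memLp 2 f ->
       memL2_dyad (@scattering_dyad R n psi m f) /\
       sqnorm_dyad (@scattering_dyad R n psi m f) =
         ((C ^+ m)%:E * Lpnorm 2 f ^+ 2)%E).
Proof.
move=> n0 _ [/memLp1_cintegrable I1 /memLp2P I2 _] _.
split=> C LP f /memLp2P If; rewrite sqr_Lpnorm2.
- have E := sqnorm_scattering_cont n0 I1 I2 m LP If; split => //.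
  split.
  + move=> l l0; apply: Lpnorm2_fin_num.
    exact: square_integrable_scattering_cont.
  + exact: measurable_funTS (measurable_scattering_cont I2 If).
  + rewrite E lte_mul_pinfty ?lee_fin ?exprn_ge0 ?(ltW LP.1)//; exact: If.2.
- have E := sqnorm_scattering_dyad n0 I1 I2 m LP If; split => //.
  split.
  + move=> j; apply: Lpnorm2_fin_num.
    exact: square_integrable_scattering_dyad.
  + rewrite E lte_mul_pinfty ?lee_fin ?exprn_ge0 ?(ltW LP.1)//; exact: If.2.
Qed.
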